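(* The class of languages recognisable in $O(1)$ time by an $\mathrm{ASRAM}[+,/,\leftarrow,\mathit{Bool}]$ equals the arithmetical hierarchy $\mathrm{AH}=\bigcup_{i\ge 0}(\Sigma^0_i\cup\Pi^0_i)$.
   Context: A $\mathrm{RAM}[\mathit{op}]$ is a unit-cost random access machine with registers holding nonnegative integers, direct and indirect addressing, conditional jumps, an equality comparator, and the operations in $\mathit{op}$ each costing one time unit. Here $+$ is addition, $/$ is exact division (giving $a/b$, defined only when $b$ divides $a$), $a\leftarrow b=a\cdot 2^b$, and $\mathit{Bool}$ denotes the bitwise Boolean operations. The input integer is placed in $R[0]$, other registers are $0$; the machine accepts iff $R[0]\neq 0$ at termination. ALS set: a nonempty set $\mathbf{S}$ of infinite integer sequences such that for every $i$ and every $\{A_k\}\in\mathbf{S}$ there is $\{B_k\}\in\mathbf{S}$ with $B_i=A_i+1$ and $B_j=A_j$ for all $j<i$. ASRAM: an $\mathrm{ASRAM}[\mathit{op}]$ is a $\mathrm{RAM}[\mathit{op}]$ program that may also call a pseudofunction $\mathit{ALN}()$ returning an integer. It computes $f$ if for each input $\mathit{inp}$ there is an ALS set $\mathbf{S}$ such that for every $\{A_i\}\in\mathbf{S}$, replacing the $i$-th invocation of $\mathit{ALN}()$ by $A_i$ yields a RAM computing $f(\mathit{inp})$. It recognises a language $L\subseteq\mathbb{N}$ if it computes a function nonzero exactly on $L$. Its running time on $\mathit{inp}$ is the worst case over all sequences $\{A_i\}$ of the running time of the resulting RAM; $O(1)$ time means this is bounded by a constant independent of the input. *)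

(* Defs.v *)
From Stdlib Require Import Arith List Bool.
Import ListNotations.

Inductive binop : Type :=
| OAdd
| ODiv
| OShl
| OAnd
| OOr
| OXor.

Inductive instr : Type :=
| IConst (i c : nat)
| IMove  (i j : nat)
| ILoad  (i j : nat)
| IStore (i j : nat)
| IOp    (o : binop) (i j k : nat)
| IJeq   (i j l : nat)
| IHalt
| IAln   (i : nat).

Definition program := list instr.
Definition regs := nat -> nat.

Definition upd (r : regs) (a v : nat) : regs :=
  fun x => if Nat.eqb x a then v else r x.

Record config := Cfg { pc : nat; rg : regs; nalns : nat }.

Inductive status : Type :=
| Running (c : config)
| Halted (r : regs)
| Stuck.

Definition eval_op (o : binop) (a b : nat) : option nat :=
  match o with
  | OAdd => Some (a + b)
  | ODiv => if (negb (Nat.eqb b 0)) && Nat.eqb (Nat.modulo a b) 0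
            then Some (Nat.div a b) else None
  | OShl => Some (a * 2 ^ b)
  | OAnd => Some (Nat.land a b)
  | OOr  => Some (Nat.lor a b)
  | OXor => Some (Nat.lxor a b)
  end.

(* One step; [A k] is the value returned by the k-th (0-based) invocation
   of ALN() during the execution. *)
Definition step (P : program) (A : nat -> nat) (c : config) : status :=
  let r := rg c in
  let nx := S (pc c) in
  match nth_error P (pc c) with
  | None => Halted r
  | Some ins =>
    match ins with
    | IConst i v => Running (Cfg nx (upd r i v) (nalns c))
    | IMove i j => Running (Cfg nx (upd r i (r j)) (nalns c))
    | ILoad i j => Running (Cfg nx (upd r i (r (r j))) (nalns c))
    | IStore i j => Running (Cfg nx (upd r (r i) (r j)) (nalns c))
    | IOp o i j k =>
        match eval_op o (r j) (r k) with
        | Some v => Running (Cfg nx (upd r i v) (nalns c))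
        | None => Stuck
        end
    | IJeq i j l =>
        if Nat.eqb (r i) (r j) then Running (Cfg l r (nalns c))
        else Running (Cfg nx r (nalns c))
    | IHalt => Halted r
    | IAln i => Running (Cfg nx (upd r i (A (nalns c))) (S (nalns c)))
    end
  end.

Fixpoint exec (P : program) (A : nat -> nat) (n : nat) (s : status) : status :=
  match n with
  | O => s
  | S m => match s with
           | Running c => exec P A m (step P A c)
           | _ => s
           end
  end.

Definition init (inp : nat) : status :=
  Running (Cfg 0 (fun x => if Nat.eqb x 0 then inp else 0) 0).

Definition ALS (S : (nat -> nat) -> Prop) : Prop :=
  (exists A, S A) /\
  forall i A, S A -> exists B, S B /\ B i = A i + 1 /\ forall j, j < i -> B j = A j.

Definition asram_computes (P : program) (f : nat -> nat) : Prop :=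
  forall inp, exists S, ALS S /\
    forall A, S A -> exists n r, exec P A n (init inp) = Halted r /\ r 0 = f inp.

Definition asram_recognises (P : program) (L : nat -> Prop) : Prop :=
  exists f, asram_computes P f /\ forall inp, f inp <> 0 <-> L inp.

Definition stopped (s : status) : Prop :=
  match s with Running _ => False | _ => True end.

Definition asram_const_time (P : program) : Prop :=
  exists T, forall inp (A : nat -> nat), stopped (exec P A T (init inp)).

Definition O1_ASRAM_language (L : nat -> Prop) : Prop :=
  exists P : program, asram_recognises P L /\ asram_const_time P.

Definition env := nat -> nat.
Definition scons (y : nat) (e : env) : env :=
  fun x => match x with O => y | S x' => e x' end.

Inductive term : Type :=
| TVar (i : nat) | TZero | TSucc (t : term)
| TAdd (t u : term) | TMul (t u : term).

Fixpoint teval (e : env) (t : term) : nat :=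
  match t with
  | TVar i => e i
  | TZero => 0
  | TSucc t => S (teval e t)
  | TAdd t u => teval e t + teval e u
  | TMul t u => teval e t * teval e u
  end.

Inductive d0form : Type :=
| FEq (t u : term)
| FLe (t u : term)
| FNot (p : d0form)
| FAnd (p q : d0form)
| FOr (p q : d0form)
| FBall (t : term) (p : d0form)
| FBex (t : term) (p : d0form).

Fixpoint d0sat (e : env) (p : d0form) : Prop :=
  match p with
  | FEq t u => teval e t = teval e u
  | FLe t u => teval e t <= teval e u
  | FNot p => ~ d0sat e p
  | FAnd p q => d0sat e p /\ d0sat e q
  | FOr p q => d0sat e p \/ d0sat e q
  | FBall t p => forall x, x < teval e t -> d0sat (scons x e) p
  | FBex t p => exists x, x < teval e t /\ d0sat (scons x e) p
  end.

Fixpoint Sigma (n : nat) (R : env -> Prop) {struct n} : Prop :=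
  match n with
  | O => exists p, forall e, R e <-> d0sat e p
  | S m => exists R', Pi m R' /\ forall e, R e <-> exists y, R' (scons y e)
  end
with Pi (n : nat) (R : env -> Prop) {struct n} : Prop :=
  match n with
  | O => exists p, forall e, R e <-> d0sat e p
  | S m => exists R', Sigma m R' /\ forall e, R e <-> forall y, R' (scons y e)
  end.

Definition zenv : env := fun _ => 0.

Definition Sigma0_lang (n : nat) (L : nat -> Prop) : Prop :=
  exists R, Sigma n R /\ forall x, L x <-> R (scons x zenv).
Definition Pi0_lang (n : nat) (L : nat -> Prop) : Prop :=
  exists R, Pi n R /\ forall x, L x <-> R (scons x zenv).

Definition AH (L : nat -> Prop) : Prop :=
  exists i, Sigma0_lang i L \/ Pi0_lang i L.

(* Main.v *)
From Stdlib Require Import Arith List Bool Lia Classical ClassicalEpsilon.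
From Stdlib Require Import FunctionalExtensionality.
Require Import Defs.
Import ListNotations.

(* ALS sets amount to iterated quantifiers: for almost all x_0, for almost all x_1, etc.
   Hence a language recognised within T steps is expressed by T such quantifiers in front of
   the halting condition of a T-step run, which is first-order definable in arithmetic by
   symbolic execution, once exponentiation to base 2 is defined.

   Conversely, in a first-order formula replace the quantifiers at depth d by quantifiers
   bounded by 2 ^ A_d: if every A_d is large enough with respect to its predecessors, truth
   does not change. The truth table of the bounded formula, over all values of its free
   variables in the box, is a single integer, computed by a straight-line program: tables
   of variables and of products of two variables are sums of geometric type, which exact
   division evaluates; equality of entries and the existential quantifier are both tests
   for nonzero fields, done in parallel through carries of one addition. *)

(** * Iterated almost-all quantifiers *)

(** The instruction set multiplies only by powers of two, and this shapes the tables. Box sides are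
    [2 ^ A l] and digit weights are [2 ^ 2 ^ u], so that [B ^ N], for [B = 2 ^ 2 ^ s] and
    [N = 2 ^ n], is [2 ^ 2 ^ (s + n)]: summing over a box side costs an addition of exponents,
    shifts and a division. Widths grow from the innermost level outwards, while the numbers are
    chosen from the outermost level inwards; the last one, [A D], can therefore dominate all box
    sides and fix the width of an entry. Bad choices may give wrong answers, but not long runs,
    since the program has no jumps. In the other direction constant time matters twice: a run of [T]
    steps sees at most [T] values, which bounds the number of quantifiers, and it unfolds into a
    fixed finite formula, without any coding of computation histories. All members of an ALS set
    give the same verdict, so either acceptance or rejection holds for almost all choices; both
    cannot, as two such properties have a common point. *)

Fixpoint almost (k r : nat) (A : nat -> nat) (Q : (nat -> nat) -> Prop) : Prop :=
  match r with
  | O => Q A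
  | S r' => exists N, forall x, N <= x -> almost (S k) r' (upd A k x) Q
  end.

Definition agree (k : nat) (A B : nat -> nat) : Prop := forall j, j < k -> A j = B j.

(** A run of [m] steps consults at most [m] values, which is what lets finitely many quantifiers
    stand for a whole sequence. *)
Definition finitary (m : nat) (Q : (nat -> nat) -> Prop) : Prop :=
  forall A B, agree m A B -> Q A -> Q B.

Lemma upd_eq (r : regs) a v : upd r a v a = v.
Proof. unfold upd; now rewrite Nat.eqb_refl. Qed.

Lemma upd_neq (r : regs) a v x : x <> a -> upd r a v x = r x.
Proof. intros H; unfold upd; now rewrite (proj2 (Nat.eqb_neq x a) H). Qed.

Lemma agree_sym k A B : agree k A B -> agree k B A.
Proof. intros H j Hj; symmetry; auto. Qed.

Lemma agree_trans k A B C : agree k A B -> agree k B C -> agree k A C.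
Proof. intros H1 H2 j Hj; rewrite H1; auto. Qed.

Lemma agree_weaken k l A B : k <= l -> agree l A B -> agree k A B.
Proof. intros H1 H2 j Hj; apply H2; lia. Qed.

Lemma agree_upd k A x : agree k A (upd A k x).
Proof. intros j Hj; rewrite upd_neq; auto; lia. Qed.

Lemma agree_upd_S k A B x : agree k A B -> agree (S k) (upd A k x) (upd B k x).
Proof.
  intros H j Hj; unfold upd; destruct (Nat.eqb_spec j k); auto; apply H; lia.
Qed.

(** The implication is asked only at sequences agreeing with [A] below [k], so that its proof may
    use the values already fixed by outer quantifiers. *)
Lemma almost_impl r : forall k A (Q1 Q2 : (nat -> nat) -> Prop),
  (forall A', agree k A A' -> Q1 A' -> Q2 A') ->
  almost k r A Q1 -> almost k r A Q2.
Proof.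
  induction r as [|r IH]; simpl; intros k A Q1 Q2 H.
  - apply H; intros j _; reflexivity.
  - intros [N HN]; exists N; intros x Hx.
    apply (IH _ _ Q1); [|auto].
    intros A' HA; apply H.
    apply agree_trans with (upd A k x); [apply agree_upd|].
    apply agree_weaken with (S k); auto.
Qed.

Lemma almost_true r : forall k A (Q : (nat -> nat) -> Prop),
  (forall A', agree k A A' -> Q A') -> almost k r A Q.
Proof.
  intros k A Q H; apply (almost_impl r k A (fun _ => True)); auto.
  clear H Q; revert k A; induction r; simpl; auto; intros; exists 0; auto.
Qed.

Lemma almost_and r : forall k A Q1 Q2,
  almost k r A Q1 -> almost k r A Q2 -> almost k r A (fun A' => Q1 A' /\ Q2 A').
Proof.
  induction r as [|r IH]; simpl; auto.
  intros k A Q1 Q2 [N1 H1] [N2 H2]; exists (N1 + N2); intros x Hx.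
  apply IH; [apply H1 | apply H2]; lia.
Qed.

Lemma almost_forall_lt r k A M (Q : nat -> (nat -> nat) -> Prop) :
  (forall y, y < M -> almost k r A (Q y)) ->
  almost k r A (fun A' => forall y, y < M -> Q y A').
Proof.
  induction M as [|M IH]; intros H.
  - apply almost_true; intros; lia.
  - apply almost_impl with
      (Q1 := fun A' => (forall y, y < M -> Q y A') /\ Q M A').
    + intros A' _ [H1 H2] y Hy.
      destruct (Nat.eq_dec y M) as [->|]; auto; apply H1; lia.
    + apply almost_and; auto.
Qed.

(** Combined with [almost_and], this is the consistency of the quantifier: contradictory properties
    cannot both hold for almost all choices. *)
Lemma almost_inhabited r : forall k A Q, almost k r A Q -> exists A', Q A'.
Proof.
  induction r as [|r IH]; simpl; intros k A Q; [eauto|].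
  intros [N H]; eapply IH, (H N); auto.
Qed.

(** The values at [k] up to [k + r - 1] are overwritten by the quantifiers, and [Q] does not see
    those from [k + r] on. *)
Lemma almost_ext r : forall k A B Q, finitary (k + r) Q ->
  agree k A B -> almost k r A Q -> almost k r B Q.
Proof.
  induction r as [|r IH]; simpl; intros k A B Q HQ HAB.
  - rewrite Nat.add_0_r in HQ; apply HQ; auto.
  - intros [N H]; exists N; intros x Hx.
    apply (IH _ (upd A k x)); auto.
    + now rewrite Nat.add_succ_comm.
    + now apply agree_upd_S.
Qed.

Lemma almost_skip a : forall k r A Q,
  (forall A', almost (k + a) r A' Q) -> almost k (a + r) A Q.
Proof.
  induction a as [|a IH]; simpl; intros k r A Q H.
  - rewrite Nat.add_0_r in H; auto.
  - exists 0; intros x _; apply IH; intros A'.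
    now rewrite Nat.add_succ_comm.
Qed.

(** * ALS sets versus almost-all quantifiers *)

(** An increment at [i] may alter every later term, so only the terms below [i] are kept along the
    iteration. *)
Lemma ALS_ge S : ALS S -> forall i A, S A -> forall x, A i <= x ->
  exists B, S B /\ B i = x /\ agree i A B.
Proof.
  intros [_ HS] i A HA x Hx.
  induction Hx as [|x Hx [B [HB [<- HAB]]]].
  - exists A; repeat split; auto.
  - destruct (HS i B HB) as [C [HC [Hi Hj]]].
    exists C; split; [auto|split; [lia|]].
    intros j Hlt; rewrite Hj; auto.
Qed.

(** The members of [S] supply the thresholds: once the first [k] values are realised by a member
    [A], every value from [A k] on is realised by a member with the same prefix. *)
Lemma ALS_almost S Q m : ALS S -> finitary m Q -> (forall A, S A -> Q A) ->
  forall A, almost 0 m A Q.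
Proof.
  intros HS HQ H.
  assert (G : forall r k, k + r = m -> forall A, S A -> almost k r A Q).
  { induction r as [|r IH]; simpl; intros k Hk A HA; [auto|].
    exists (A k); intros x Hx.
    destruct (ALS_ge S HS k A HA x Hx) as [B [HB [Hi HAB]]].
    apply (almost_ext r (Datatypes.S k) B).
    - now replace (Datatypes.S k + r) with m by lia.
    - intros j Hj; unfold upd; destruct (Nat.eqb_spec j k) as [->|]; auto.
      symmetry; apply HAB; lia.
    - apply IH; auto; lia. }
  intros A; destruct (proj1 HS) as [A0 HA0].
  apply (almost_ext m 0 A0); auto.
  intros j Hj; lia.
Qed.

(* Requiring the tail condition for all [x >= A k], and not just for [A k],
   makes the set closed under increments. *)
Definition almost_set (m : nat) (Q : (nat -> nat) -> Prop) (A : nat -> nat) : Prop :=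
  forall k, k < m -> forall x, A k <= x -> almost (S k) (m - S k) (upd A k x) Q.

(** Each threshold becomes the value at its position. The conditions collected for earlier positions
    survive because they depend on shorter prefixes only. *)
Lemma almost_set_extend m Q : finitary m Q -> forall r k A, k + r = m ->
  (forall j, j < k -> forall x, A j <= x -> almost (S j) (m - S j) (upd A j x) Q) ->
  almost k r A Q -> exists B, almost_set m Q B /\ agree k A B.
Proof.
  intros HQ; induction r as [|r IH]; simpl; intros k A Hk Hpre Hal.
  - exists A; split; [|intros j _; reflexivity].
    intros j Hj; apply Hpre; lia.
  - destruct Hal as [N HN].
    destruct (IH (S k) (upd A k N)) as [B [HB HAB]]; [lia| |auto|].
    + intros j Hj x Hx; unfold upd at 1 in Hx.
      destruct (Nat.eqb_spec j k) as [->|Hne].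
      * replace (m - S k) with r by lia.
        apply (almost_ext r (S k) (upd A k x)); auto.
        -- now replace (S k + r) with m by lia.
        -- apply agree_upd_S, agree_upd.
      * apply (almost_ext (m - S j) (S j) (upd A j x)).
        -- now replace (S j + (m - S j)) with m by lia.
        -- apply agree_upd_S; intros i Hi; rewrite upd_neq; auto; lia.
        -- apply Hpre; auto; lia.
    + exists B; split; auto.
      apply agree_trans with (upd A k N); [apply agree_upd|].
      apply agree_weaken with (S k); auto.
Qed.

(** After an increment at [i < m] the tail is rebuilt from the condition at [i], which covers all
    larger values; an increment at [i >= m] is invisible to [Q]. *)
Lemma almost_ALS m Q A : finitary m Q -> almost 0 m A Q ->
  exists S, ALS S /\ forall B, S B -> Q B.
Proof.
  (* For [m > 0], [Q B] is the condition at position [m - 1]; for [m = 0], [almost_set] says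
     nothing, so [Q B] is carried along. *)
  intros HQ HA; exists (fun B => almost_set m Q B /\ Q B); split; [|tauto].
  assert (last : forall r k C, k + r = m -> (forall j, j < k -> forall x, C j <= x ->
      almost (S j) (m - S j) (upd C j x) Q) ->
      almost k r C Q -> exists B, (almost_set m Q B /\ Q B) /\ agree k C B).
  { intros r k C Hk H1 H2.
    destruct (almost_set_extend m Q HQ r k C) as [B [HB Hag]]; auto.
    exists B; split; auto; split; auto.
    destruct m as [|m].
    - assert (k = 0) by lia; assert (r = 0) by lia; subst.
      apply (HQ C); auto.
    - specialize (HB m (Nat.lt_succ_diag_r m) (B m) (le_n _)) as HBm.
      rewrite Nat.sub_diag in HBm; simpl in HBm.
      revert HBm; apply HQ; intros j _.
      unfold upd; destruct (Nat.eqb_spec j m) as [->|]; auto. }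
  split.
  - destruct (last m 0 A) as [B [HB _]]; auto; [intros; lia|eauto].
  - intros i B [HB HQB].
    destruct (le_lt_dec m i) as [Hi|Hi].
    + exists (upd B i (B i + 1)); split; [split|split].
      * intros k Hk x Hx; rewrite upd_neq in Hx by lia.
        apply (almost_ext (m - S k) (S k) (upd B k x)).
        -- now replace (S k + (m - S k)) with m by lia.
        -- apply agree_upd_S; intros j Hj; rewrite upd_neq; auto; lia.
        -- auto.
      * revert HQB; apply HQ; intros j Hj; rewrite upd_neq; auto; lia.
      * apply upd_eq.
      * intros j Hj; apply upd_neq; lia.
    + destruct (last (m - S i) (S i) (upd B i (B i + 1))) as [C [HC Hag]]; [lia| | |].
      * intros j Hj x Hx; apply (almost_ext (m - S j) (S j) (upd B j x)).
        -- now replace (S j + (m - S j)) with m by lia.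
        -- apply agree_upd_S; intros l Hl; rewrite upd_neq; auto; lia.
        -- apply HB; [lia|]; unfold upd in Hx.
           destruct (Nat.eqb_spec j i) as [->|]; lia.
      * apply HB; auto; lia.
      * exists C; split; auto; split.
        -- rewrite <- Hag by lia; apply upd_eq.
        -- intros j Hj; rewrite <- Hag by lia; apply upd_neq; lia.
Qed.

(** * Definability in first-order arithmetic *)

(* Multiplication relates fixed, hence distinct, variables: the table of [e i * e j] is a
   product of one-variable sums only if [i <> j]. *)
Inductive fo : Type :=
| FoOne (i : nat)
| FoAdd (i j k : nat)
| FoMul
| FoNot (p : fo)
| FoAnd (p q : fo)
| FoEx (p : fo).

Fixpoint fosat (e : env) (p : fo) : Prop :=
  match p with
  | FoOne i => e i = 1
  | FoAdd i j k => e i + e j = e k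
  | FoMul => e 0 * e 1 = e 2
  | FoNot p => ~ fosat e p
  | FoAnd p q => fosat e p /\ fosat e q
  | FoEx p => exists y, fosat (scons y e) p
  end.

Definition definable (R : env -> Prop) : Prop :=
  exists p, forall e, R e <-> fosat e p.

Definition fundef (F : env -> nat) : Prop :=
  definable (fun e => e 0 = F (fun i => e (S i))).

Definition up (rho : nat -> nat) (i : nat) : nat :=
  match i with O => O | S j => S (rho j) end.

Lemma scons_up x (e : env) rho :
  (fun i => scons x e (up rho i)) = scons x (fun i => e (rho i)).
Proof. extensionality i; destruct i; reflexivity. Qed.

Lemma definable_iff (R R' : env -> Prop) :
  (forall e, R' e <-> R e) -> definable R -> definable R'.
Proof. intros H [p Hp]; exists p; intros e; now rewrite H. Qed.

Lemma definable_not (R : env -> Prop) : definable R -> definable (fun e => ~ R e).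
Proof. intros [p Hp]; exists (FoNot p); intros e; simpl; now rewrite Hp. Qed.

Lemma definable_and (R R' : env -> Prop) :
  definable R -> definable R' -> definable (fun e => R e /\ R' e).
Proof.
  intros [p Hp] [q Hq]; exists (FoAnd p q); intros e; simpl; now rewrite Hp, Hq.
Qed.

(** The hypothesis avoids [scons]: after beta reduction the goal speaks of plain variables again,
    and the closure lemmas keep matching under nested quantifiers. *)
Lemma definable_ex (Q : nat -> env -> Prop) :
  definable (fun e => Q (e 0) (fun i => e (S i))) ->
  definable (fun e => exists y, Q y e).
Proof.
  intros [p Hp]; exists (FoEx p); intros e; simpl.
  split; intros [y Hy]; exists y; [apply (Hp (scons y e)) in Hy | apply (Hp (scons y e))];
    exact Hy.
Qed.

Lemma definable_or (R R' : env -> Prop) :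
  definable R -> definable R' -> definable (fun e => R e \/ R' e).
Proof.
  intros H H'; apply definable_iff with (fun e => ~ (~ R e /\ ~ R' e)).
  - intros e; tauto.
  - apply definable_not, definable_and; now apply definable_not.
Qed.

Lemma definable_imp (R R' : env -> Prop) :
  definable R -> definable R' -> definable (fun e => R e -> R' e).
Proof.
  intros H H'; apply definable_iff with (fun e => ~ R e \/ R' e).
  - intros e; tauto.
  - apply definable_or; auto; now apply definable_not.
Qed.

Lemma definable_equiv (R R' : env -> Prop) :
  definable R -> definable R' -> definable (fun e => R e <-> R' e).
Proof. intros H H'; apply definable_and; apply definable_imp; auto. Qed.

Lemma definable_all (Q : nat -> env -> Prop) :
  definable (fun e => Q (e 0) (fun i => e (S i))) ->
  definable (fun e => forall y, Q y e).
Proof.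
  intros H; apply definable_iff with (fun e => ~ exists y, ~ Q y e).
  - intros e; split; [intros Ha [y Hy]; auto|].
    intros Hn y; apply NNPP; intros Hy; apply Hn; eauto.
  - apply definable_not, definable_ex, definable_not, H.
Qed.

Lemma definable_eq_var i j : definable (fun e => e i = e j).
Proof.
  (* [y + y = y] forces the auxiliary variable to be [0]. *)
  exists (FoEx (FoAnd (FoAdd 0 0 0) (FoAdd (S i) 0 (S j)))).
  intros e; simpl; split; [exists 0; lia | intros [y H]; lia].
Qed.

(** The factors and the product are copied into three fresh bound variables, which occupy the
    indices [0], [1], [2] that [FoMul] demands. *)
Lemma definable_mul_var i j k : definable (fun e => e i * e j = e k).
Proof.
  apply definable_iff with
    (fun e => exists c, exists b, exists a, a = e i /\ b = e j /\ c = e k /\ a * b = c).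
  - intros e; split; [intros; exists (e k), (e j), (e i); auto|].
    intros [c [b [a [-> [-> [-> H]]]]]]; exact H.
  - do 3 apply definable_ex.
    repeat apply definable_and; try apply definable_eq_var.
    exists FoMul; intros e; reflexivity.
Qed.

Lemma definable_ren (R : env -> Prop) (rho : nat -> nat) :
  definable R -> definable (fun e => R (fun i => e (rho i))).
Proof.
  intros [p Hp].
  apply definable_iff with (fun e => fosat (fun i => e (rho i)) p); [intros; apply Hp|].
  clear R Hp; revert rho; induction p as [i|i j k| |p IH|p IH q IH'|p IH]; intros rho; simpl.
  - exists (FoOne (rho i)); reflexivity.
  - exists (FoAdd (rho i) (rho j) (rho k)); reflexivity.
  - apply definable_mul_var.
  - apply definable_not, IH.
  - apply definable_and; auto.
  - apply (definable_ex (fun y e => fosat (scons y (fun i => e (rho i))) p)).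
    apply definable_iff with (2 := IH (up rho)).
    intros e.
    replace (scons (e 0) (fun i => e (S (rho i)))) with (fun i => e (up rho i)); [tauto|].
    extensionality i; destruct i; reflexivity.
Qed.

Lemma fundef_ren (F : env -> nat) (rho : nat -> nat) :
  fundef F -> fundef (fun e => F (fun i => e (rho i))).
Proof.
  exact (definable_ren (fun e => e 0 = F (fun i => e (S i))) (up rho)).
Qed.

Lemma fundef_ext (F F' : env -> nat) :
  (forall e, F' e = F e) -> fundef F -> fundef F'.
Proof. intros H; apply definable_iff; intros e; now rewrite H. Qed.

Lemma fundef_var i : fundef (fun e => e i).
Proof. exact (definable_eq_var 0 (S i)). Qed.

Lemma definable_eq (F G : env -> nat) :
  fundef F -> fundef G -> definable (fun e => F e = G e).
Proof.
  intros HF HG; apply definable_iff with (fun e => exists y, y = F e /\ y = G e).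
  - intros e; split; [eauto|intros [y [<- H]]; exact H].
  - apply definable_ex, definable_and; auto.
Qed.

Lemma definable_subst (R : nat -> env -> Prop) (F : env -> nat) : fundef F ->
  definable (fun e => R (e 0) (fun i => e (S i))) -> definable (fun e => R (F e) e).
Proof.
  intros HF HR; apply definable_iff with (fun e => exists y, y = F e /\ R y e).
  - intros e; split; [eauto|intros [y [-> H]]; exact H].
  - apply definable_ex, definable_and; auto.
Qed.

Lemma definable_subst3 (R : nat -> nat -> nat -> Prop) (F G H : env -> nat) :
  fundef F -> fundef G -> fundef H ->
  definable (fun e => R (e 0) (e 1) (e 2)) ->
  definable (fun e => R (F e) (G e) (H e)).
Proof.
  intros HF HG HH HR.
  apply (definable_subst (fun z e => R (F e) (G e) z)); auto.
  apply (definable_subst (fun y e => R (F (fun i => e (S i))) y (e 0)));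
    [exact (fundef_ren G S HG)|].
  apply (definable_subst (fun x e => R x (e 0) (e 1)));
    [exact (fundef_ren F (fun i => S (S i)) HF)|].
  exact HR.
Qed.

Lemma fundef_graph (R : nat -> nat -> nat -> Prop) (op : nat -> nat -> nat) F G :
  (forall a b c, R a b c <-> c = op a b) ->
  definable (fun e => R (e 0) (e 1) (e 2)) ->
  fundef F -> fundef G -> fundef (fun e => op (F e) (G e)).
Proof.
  intros H HR HF HG; unfold fundef.
  apply definable_iff with
    (fun e => R (F (fun i => e (S i))) (G (fun i => e (S i))) (e 0)).
  - intros e; now rewrite H.
  - apply definable_subst3; auto.
    + exact (fundef_ren F S HF).
    + exact (fundef_ren G S HG).
    + apply fundef_var.
Qed.

Lemma fundef_add (F G : env -> nat) : fundef F -> fundef G -> fundef (fun e => F e + G e).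
Proof.
  apply fundef_graph with (R := fun a b c => a + b = c); [split; auto|].
  exists (FoAdd 0 1 2); reflexivity.
Qed.

Lemma fundef_mul (F G : env -> nat) : fundef F -> fundef G -> fundef (fun e => F e * G e).
Proof.
  apply fundef_graph with (R := fun a b c => a * b = c); [split; auto|].
  exists FoMul; reflexivity.
Qed.

Lemma fundef_const c : fundef (fun _ => c).
Proof.
  induction c as [|c IH].
  - exists (FoAdd 0 0 0); intros e; simpl; lia.
  - apply fundef_ext with (fun _ => c + 1); [intros; lia|].
    apply (fundef_add (fun _ => c) (fun _ => 1)); auto.
    exists (FoOne 0); reflexivity.
Qed.

Lemma definable_le (F G : env -> nat) :
  fundef F -> fundef G -> definable (fun e => F e <= G e).
Proof.
  intros HF HG; apply definable_iff with (fun e => exists z, F e + z = G e).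
  - intros e; split; [exists (G e - F e); lia|intros [z H]; lia].
  - apply definable_ex, definable_eq.
    + apply fundef_add; [exact (fundef_ren F S HF)|apply fundef_var].
    + exact (fundef_ren G S HG).
Qed.

Lemma definable_lt (F G : env -> nat) :
  fundef F -> fundef G -> definable (fun e => F e < G e).
Proof.
  intros HF HG; apply definable_iff with (fun e => F e + 1 <= G e); [intros; lia|].
  apply definable_le; auto; apply fundef_add; auto; apply fundef_const.
Qed.

Lemma fundef_cases (R : env -> Prop) (F G H : env -> nat) :
  definable R -> fundef F -> fundef G ->
  (forall e, R e -> H e = F e) -> (forall e, ~ R e -> H e = G e) -> fundef H.
Proof.
  intros HR HF HG H1 H2.
  apply definable_iff with (fun e => (R (fun i => e (S i)) /\ e 0 = F (fun i => e (S i)))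
    \/ (~ R (fun i => e (S i)) /\ e 0 = G (fun i => e (S i)))).
  - intros e; destruct (classic (R (fun i => e (S i)))) as [Hr|Hr].
    + rewrite (H1 _ Hr); tauto.
    + rewrite (H2 _ Hr); tauto.
  - pose proof (definable_ren R S HR).
    apply definable_or; apply definable_and; auto.
    now apply definable_not.
Qed.

Ltac fundef_hyp :=
  match goal with
  | H : fundef ?F |- fundef _ => exact H
  | H : fundef ?F |- fundef _ => refine (fundef_ren F _ H)
  end.

Ltac definability :=
  repeat (cbv beta; lazymatch goal with
    | |- definable (fun e => exists y, _) => apply definable_ex
    | |- definable (fun e => _ /\ _) => apply definable_and
    | |- definable (fun e => _ \/ _) => apply definable_or
    | |- definable (fun e => ~ _) => apply definable_not
    | |- definable (fun e => _ <-> _) => apply definable_equiv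
    | |- definable (fun e => _ = _) => apply definable_eq
    | |- definable (fun e => _ <= _) => apply definable_le
    | |- definable (fun e => _ < _) => apply definable_lt
    | |- definable (fun e => forall y : nat, _) => apply definable_all
    | |- definable (fun e => _ -> _) => apply definable_imp
    | |- fundef (fun e => _ + _) => apply fundef_add
    | |- fundef (fun e => _ * _) => apply fundef_mul
    | |- fundef _ => first [fundef_hyp | apply fundef_var | apply fundef_const]
    end).

(** * Powers of two and binary digits *)

(** The only odd divisor is [1]: a description by multiplication alone. It excludes [0], which [3]
    divides. *)
Definition isPow2 (p : nat) : Prop :=
  forall d, (exists c, d * c = p) -> d = 1 \/ exists c, 2 * c = d.

Lemma isPow2_spec p : isPow2 p <-> exists k, p = 2 ^ k.
Proof.
  split.
  - induction p as [p IH] using lt_wf_ind; intros H.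
    destruct (H p) as [->|[c Hc]]; [exists 1; lia| exists 0; reflexivity|].
    destruct (Nat.eq_dec c 0) as [->|Hc0].
    + destruct (H 3) as [H3|[c H3]]; [exists 0|..]; lia.
    + destruct (IH c) as [k Hk]; [lia| |exists (S k); simpl; lia].
      intros d [b Hb]; apply H; exists (2 * b); nia.
  - intros [k ->]; induction k as [|k IH]; intros d [c Hc].
    + left; now apply Nat.eq_mul_1 in Hc.
    + destruct (Nat.Even_or_Odd d) as [[h ->]|[h Hh]]; [right; eauto|left].
      destruct (Nat.Even_or_Odd c) as [[b ->]|[b Hb]].
      * destruct (IH d) as [|[a Ha]]; [exists b; simpl in Hc; nia|auto|lia].
      * simpl in Hc; subst; nia.
Qed.

Lemma definable_isPow2 F : fundef F -> definable (fun e => isPow2 (F e)).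
Proof. intros HF; unfold isPow2; definability. Qed.

Lemma pow_mod_pred m k : exists h, (1 + m) ^ k = 1 + h * m.
Proof.
  induction k as [|k [h IH]]; [exists 0; reflexivity|].
  exists (h + 1 + h * m); rewrite !Nat.pow_succ_r', IH; ring.
Qed.

Lemma pow_mod_pred_sq m k : exists h, (1 + m) ^ k = 1 + k * m + h * (m * m).
Proof.
  induction k as [|k [h IH]]; [exists 0; reflexivity|].
  exists (h + k + h * m); rewrite !Nat.pow_succ_r', IH; ring.
Qed.

Lemma pow_mod_pred2 m k : exists h, (2 + m) ^ k = 2 ^ k + h * m.
Proof.
  induction k as [|k [h IH]]; [exists 0; reflexivity|].
  exists (2 * h + 2 ^ k + h * m); rewrite !Nat.pow_succ_r', IH; ring.
Qed.

(** With [k = i j + r] and [r < j], [2 ^ k] is congruent to [2 ^ r] modulo [2 ^ j - 1]. As [2 <= j],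
    [2 ^ r] lies below the modulus, so it equals [1]. *)
Lemma pow2_congr_1 j k h : 2 <= j -> 2 ^ k = 1 + h * (2 ^ j - 1) ->
  exists i, 2 ^ k = (2 ^ j) ^ i.
Proof.
  intros Hj H; exists (k / j).
  pose proof (Nat.div_mod_eq k j) as Hk.
  pose proof (Nat.mod_upper_bound k j ltac:(lia)) as Hr.
  set (i := k / j) in *; set (r := k mod j) in *.
  assert (Hm : 4 <= 2 ^ j) by (change 4 with (2 ^ 2); apply Nat.pow_le_mono_r; lia).
  assert (H2r : 2 * 2 ^ r <= 2 ^ j)
    by (change (2 ^ S r <= 2 ^ j); apply Nat.pow_le_mono_r; lia).
  destruct (pow_mod_pred (2 ^ j - 1) i) as [g Hg].
  replace (1 + (2 ^ j - 1)) with (2 ^ j) in Hg by lia.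
  assert (E : 2 ^ k = (2 ^ j) ^ i * 2 ^ r) by (rewrite Hk, Nat.pow_add_r, Nat.pow_mul_r; lia).
  rewrite Hg in E.
  assert (Hr1 : 2 ^ r = 1).
  { assert (0 < 2 ^ r) by (apply Nat.neq_0_lt_0, Nat.pow_nonzero; lia).
    set (m := 2 ^ j - 1) in *; set (y := 2 ^ r) in *.
    assert (Hym : y < m) by lia.
    assert (Eq : 1 + h * m = y + (g * y) * m) by nia.
    assert (h = g * y) by nia.
    nia. }
  rewrite E, Hr1, Hg; lia.
Qed.

(* For a power of two [q] with [m = q - 1], the powers of [q] are the powers of two
   congruent to [1] modulo [m]; and [q ^ k = 1 + k m] modulo [m ^ 2] identifies the
   exponent, so that the least solution is [q ^ x]. *)
Definition powCand (q x p : nat) : Prop :=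
  isPow2 p /\ (exists h, p + h = 1 + h * q) /\
  exists h m, m + 1 = q /\ p = 1 + x * m + h * (m * m).

Definition powLeast (q x p : nat) : Prop :=
  powCand q x p /\ forall p', powCand q x p' -> p <= p'.

Lemma powCand_pow j x : powCand (2 ^ j) x ((2 ^ j) ^ x).
Proof.
  assert (0 < 2 ^ j) by (apply Nat.neq_0_lt_0, Nat.pow_nonzero; lia).
  set (m := 2 ^ j - 1); assert (Hq : 2 ^ j = 1 + m) by lia.
  split; [|split].
  - apply isPow2_spec; exists (j * x); now rewrite Nat.pow_mul_r.
  - destruct (pow_mod_pred m x) as [h Hh]; exists h; rewrite Hq, Hh; lia.
  - destruct (pow_mod_pred_sq m x) as [h Hh]; exists h, m; rewrite Hq, Hh; lia.
Qed.

(** By [pow2_congr_1] a candidate is [q ^ i] with [q = 2 ^ j]; modulo [m * m] this gives [i]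
    congruent to [x] modulo [m = q - 1], and since [x < m] no such [i] is below [x]. *)
Lemma powCand_ge j x p : 2 <= j -> x + 1 < 2 ^ j -> powCand (2 ^ j) x p ->
  (2 ^ j) ^ x <= p.
Proof.
  intros Hj Hx [H1 [[h Hh] [g [m [Hm Hg]]]]].
  apply isPow2_spec in H1; destruct H1 as [k ->].
  destruct (pow2_congr_1 j k h) as [i Hi]; [auto| |].
  { rewrite <- Hm in *; replace (m + 1 - 1) with m by lia; lia. }
  rewrite Hi in *; apply Nat.pow_le_mono_r; [lia|].
  destruct (pow_mod_pred_sq m i) as [f Hf].
  replace (1 + m) with (2 ^ j) in Hf by lia.
  assert (E : x + g * m = i + f * m) by nia.
  destruct (le_lt_dec x i); auto; exfalso.
  assert (g < f) by nia.
  assert ((g + 1) * m <= f * m) by (apply Nat.mul_le_mono_r; lia).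
  lia.
Qed.

Lemma powLeast_spec j x p : 2 <= j -> x + 1 < 2 ^ j ->
  powLeast (2 ^ j) x p <-> p = (2 ^ j) ^ x.
Proof.
  intros Hj Hx; split.
  - intros [H1 H2]; apply Nat.le_antisymm.
    + apply H2, powCand_pow.
    + now apply powCand_ge.
  - intros ->; split; [apply powCand_pow|intros p' Hp'; now apply powCand_ge].
Qed.

(* [q ^ x = 2 ^ x] modulo [q - 2]; large moduli determine [2 ^ x]. *)
Lemma pow2_spec x y : y = 2 ^ x <->
  exists q0, forall q, q0 <= q -> isPow2 q ->
    exists p, powLeast q x p /\ exists h m, m + 2 = q /\ p = y + h * m.
Proof.
  split.
  (* [q >= 4] gives [2 <= j], and [q >= x + 4] gives [x + 1 < q], the two conditions of
     [powLeast_spec]. *)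
  - intros ->; exists (x + 4); intros q Hq H2.
    apply isPow2_spec in H2; destruct H2 as [j ->].
    exists ((2 ^ j) ^ x); split.
    + apply powLeast_spec; [|lia|auto].
      destruct j as [|[|j]]; simpl in Hq; lia.
    + destruct (pow_mod_pred2 (2 ^ j - 2) x) as [h Hh].
      replace (2 + (2 ^ j - 2)) with (2 ^ j) in Hh by lia.
      exists h, (2 ^ j - 2); lia.
  - intros [q0 H].
    (* Besides meeting the threshold [q0], this makes the modulus [2 ^ j - 2] exceed both [y] and
       [2 ^ x], so that their congruence is an equality. *)
    set (j := q0 + x + y + 2 ^ x + 4).
    assert (Hj : j < 2 ^ j) by (apply Nat.pow_gt_lin_r; lia).
    destruct (H (2 ^ j)) as [p [Hp [h [m [Hm Hy]]]]]; [lia|apply isPow2_spec; eauto|].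
    apply powLeast_spec in Hp; [|lia|lia].
    destruct (pow_mod_pred2 m x) as [g Hg].
    replace (2 + m) with (2 ^ j) in Hg by lia.
    assert (E : y + h * m = 2 ^ x + g * m) by lia.
    assert (h = g) by nia.
    nia.
Qed.

Lemma definable_powCand F G H : fundef F -> fundef G -> fundef H ->
  definable (fun e => powCand (F e) (G e) (H e)).
Proof.
  intros HF HG HH; unfold powCand.
  apply definable_and; [now apply definable_isPow2|definability].
Qed.

Lemma definable_powLeast F G H : fundef F -> fundef G -> fundef H ->
  definable (fun e => powLeast (F e) (G e) (H e)).
Proof.
  intros HF HG HH; unfold powLeast.
  apply definable_and; [now apply definable_powCand|].
  apply definable_all, definable_imp; [apply definable_powCand|]; definability.
Qed.

Lemma fundef_pow2 F : fundef F -> fundef (fun e => 2 ^ F e).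
Proof.
  intros HF; eapply definable_iff; [intros e; apply pow2_spec|].
  apply definable_ex, definable_all; apply definable_imp; [definability|].
  apply definable_imp; [apply definable_isPow2; definability|].
  apply definable_ex, definable_and; [apply definable_powLeast|]; definability.
Qed.

Lemma testbit_spec a i : Nat.testbit a i = true <->
  exists h l, l < 2 ^ i /\ a = (2 * h + 1) * 2 ^ i + l.
Proof.
  rewrite Nat.testbit_true; split.
  - intros H; exists (a / 2 ^ i / 2), (a mod 2 ^ i); split.
    + apply Nat.mod_upper_bound, Nat.pow_nonzero; lia.
    + rewrite (Nat.div_mod_eq a (2 ^ i)) at 1.
      rewrite (Nat.div_mod_eq (a / 2 ^ i) 2) at 1; rewrite H; ring.
  - intros [h [l [Hl ->]]].
    rewrite Nat.div_add_l, (Nat.div_small l) by lia.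
    rewrite Nat.add_0_r, Nat.add_comm, Nat.mul_comm.
    now rewrite Nat.Div0.mod_add.
Qed.

Lemma definable_testbit F G : fundef F -> fundef G ->
  definable (fun e => Nat.testbit (F e) (G e) = true).
Proof.
  intros HF HG; pose proof (fundef_pow2 G HG).
  eapply definable_iff; [intros e; apply testbit_spec|]; cbv beta.
  apply definable_ex, definable_ex, definable_and; [apply definable_lt|apply definable_eq].
  all: repeat first [apply fundef_add|apply fundef_mul]; cbv beta; try definability.
  all: refine (fundef_ren (fun e => 2 ^ G e) (fun i => S (S i)) _); auto.
Qed.

(** * Definable relations are exactly the arithmetical ones *)

Fixpoint ren_term (rho : nat -> nat) (t : term) : term :=
  match t with
  | TVar i => TVar (rho i)
  | TZero => TZero
  | TSucc t => TSucc (ren_term rho t)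
  | TAdd t u => TAdd (ren_term rho t) (ren_term rho u)
  | TMul t u => TMul (ren_term rho t) (ren_term rho u)
  end.

Fixpoint ren_d0 (rho : nat -> nat) (p : d0form) : d0form :=
  match p with
  | FEq t u => FEq (ren_term rho t) (ren_term rho u)
  | FLe t u => FLe (ren_term rho t) (ren_term rho u)
  | FNot p => FNot (ren_d0 rho p)
  | FAnd p q => FAnd (ren_d0 rho p) (ren_d0 rho q)
  | FOr p q => FOr (ren_d0 rho p) (ren_d0 rho q)
  | FBall t p => FBall (ren_term rho t) (ren_d0 (up rho) p)
  | FBex t p => FBex (ren_term rho t) (ren_d0 (up rho) p)
  end.

Lemma teval_ren rho t : forall e, teval e (ren_term rho t) = teval (fun i => e (rho i)) t.
Proof. induction t; simpl; intros e; auto. Qed.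

Lemma d0sat_ren p : forall rho e,
  d0sat e (ren_d0 rho p) <-> d0sat (fun i => e (rho i)) p.
Proof.
  induction p as [t u|t u|p IH|p IH q IH'|p IH q IH'|t p IH|t p IH]; simpl; intros rho e;
    rewrite ?teval_ren; try rewrite IH; try rewrite IH'; try reflexivity.
  - split; intros H x Hx; apply H in Hx; rewrite ?IH, ?scons_up in *; auto.
  - split; intros [x [Hx H]]; exists x; rewrite IH, scons_up in *; auto.
Qed.

(** * Prenex form *)

Fixpoint psat (q : list bool) (m : d0form) (e : env) : Prop :=
  match q with
  | [] => d0sat e m
  | true :: q => exists y, psat q m (scons y e)
  | false :: q => forall y, psat q m (scons y e)
  end.

Definition prenex (R : env -> Prop) : Prop :=
  exists q m, forall e, R e <-> psat q m e.

Lemma psat_ren q : forall rho m, exists m', forall e,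
  psat q m' e <-> psat q m (fun i => e (rho i)).
Proof.
  induction q as [|b q IH]; intros rho m.
  - exists (ren_d0 rho m); intros e; apply d0sat_ren.
  - destruct (IH (up rho) m) as [m' Hm']; exists m'; intros e.
    assert (H : forall y, psat q m' (scons y e) <-> psat q m (scons y (fun i => e (rho i)))).
    { intros y; now rewrite Hm', scons_up. }
    destruct b; simpl.
    + split; intros [y Hy]; exists y; apply H; auto.
    + split; intros Hy y; apply H; auto.
Qed.

Lemma prenex_iff (R R' : env -> Prop) : (forall e, R' e <-> R e) -> prenex R -> prenex R'.
Proof. intros H [q [m Hm]]; exists q, m; intros e; now rewrite H. Qed.

Lemma prenex_d0 m : prenex (fun e => d0sat e m).
Proof. exists [], m; reflexivity. Qed.

Lemma prenex_ren (R : env -> Prop) rho : prenex R -> prenex (fun e => R (fun i => e (rho i))).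
Proof.
  intros [q [m Hm]]; destruct (psat_ren q rho m) as [m' Hm'].
  exists q, m'; intros e; now rewrite Hm', Hm.
Qed.

Lemma prenex_ex (R : env -> Prop) : prenex R -> prenex (fun e => exists y, R (scons y e)).
Proof.
  intros [q [m Hm]]; exists (true :: q), m; intros e; simpl.
  split; intros [y Hy]; exists y; apply Hm; auto.
Qed.

Lemma prenex_not (R : env -> Prop) : prenex R -> prenex (fun e => ~ R e).
Proof.
  intros [q [m Hm]]; exists (map negb q), (FNot m); intros e; rewrite Hm; clear R Hm.
  revert e; induction q as [|[|] q IH]; intros e; simpl; [reflexivity|..].
  - split; [intros H y; apply IH; eauto|].
    intros H [y Hy]; apply (IH (scons y e)); auto.
  - split.
    + intros H; apply not_all_ex_not in H; destruct H as [y Hy]; exists y; now apply IH.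
    + intros [y Hy] H; apply IH in Hy; auto.
Qed.

Lemma prenex_all (R : env -> Prop) : prenex R -> prenex (fun e => forall y, R (scons y e)).
Proof.
  intros [q [m Hm]]; exists (false :: q), m; intros e; simpl.
  split; intros H y; apply Hm; auto.
Qed.

(** The quantifiers of the left conjunct are pulled out first, then those of the right one, the
    other conjunct being shifted past each. For universal quantifiers this uses that the domain is
    nonempty. *)
Lemma prenex_and (R R' : env -> Prop) :
  prenex R -> prenex R' -> prenex (fun e => R e /\ R' e).
Proof.
  intros [q [m Hm]] HR'.
  apply prenex_iff with (fun e => psat q m e /\ R' e); [intros e; now rewrite Hm|].
  clear R Hm; revert R' HR'; induction q as [|b q IH]; intros R' HR'.
  - destruct HR' as [q' [m' Hm']].
    apply prenex_iff with (fun e => d0sat e m /\ psat q' m' e);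
      [intros e; simpl; now rewrite Hm'|].
    clear R' Hm'; revert m; induction q' as [|b q' IH]; intros m.
    + exact (prenex_d0 (FAnd m m')).
    + specialize (IH (ren_d0 S m)); destruct b; [apply prenex_ex in IH|apply prenex_all in IH];
        revert IH; apply prenex_iff; intros e; simpl.
      * split.
        -- intros [H [y Hy]]; exists y; split; auto; now apply (proj2 (d0sat_ren _ _ _)).
        -- intros [y [H Hy]]; apply (proj1 (d0sat_ren _ _ _)) in H; split; [exact H|eauto].
      * split.
        -- intros [H Hy] y; split; auto; now apply (proj2 (d0sat_ren _ _ _)).
        -- intros H; split; [destruct (H 0) as [H0 _]; now apply (proj1 (d0sat_ren _ _ _)) in H0|apply H].
  - specialize (IH _ (prenex_ren R' S HR')).
    destruct b; [apply prenex_ex in IH|apply prenex_all in IH];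
        revert IH; apply prenex_iff; intros e; simpl.
    + split.
      * intros [[y Hy] H]; exists y; split; [auto|exact H].
      * intros [y [Hy H]]; split; [eauto|exact H].
    + split.
      * intros [Hy H] y; split; [auto|exact H].
      * intros H; split; [apply H|exact (proj2 (H 0))].
Qed.

Lemma definable_prenex R : definable R -> prenex R.
Proof.
  intros [p Hp]; apply prenex_iff with (fun e => fosat e p); [auto|]; clear R Hp.
  induction p as [i|i j k| |p IH|p IH q IH'|p IH]; simpl.
  - exact (prenex_d0 (FEq (TVar i) (TSucc TZero))).
  - exact (prenex_d0 (FEq (TAdd (TVar i) (TVar j)) (TVar k))).
  - exact (prenex_d0 (FEq (TMul (TVar 0) (TVar 1)) (TVar 2))).
  - now apply prenex_not.
  - now apply prenex_and.
  - exact (prenex_ex _ IH).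
Qed.

(* Strict alternation is restored by inserting vacuous quantifiers. *)
Lemma psat_hierarchy q : forall m,
  (exists n, Sigma n (psat q m)) /\ (exists n, Pi n (psat q m)).
Proof.
  induction q as [|b q IH]; intros m.
  - split; exists 0, m; reflexivity.
  - destruct (psat_ren (b :: q) S m) as [m' Hm'].
    destruct (IH m) as [[n1 H1] [n2 H2]]; destruct (IH m') as [[n3 H3] [n4 H4]].
    assert (E1 : forall e, psat (b :: q) m e <-> exists y, psat (b :: q) m' (scons y e)).
    { intros e; split; [intros H; exists 0; now apply Hm'|].
      intros [y Hy]; apply (proj1 (Hm' _)) in Hy; exact Hy. }
    assert (E2 : forall e, psat (b :: q) m e <-> forall y, psat (b :: q) m' (scons y e)).
    { intros e; split; [intros H y; now apply Hm'|].
      intros Hy; specialize (Hy 0); apply (proj1 (Hm' _)) in Hy; exact Hy. }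
    destruct b; split.
    + exists (S n2), (psat q m); split; auto; reflexivity.
    + exists (S (S n4)), (psat (true :: q) m'); split; auto.
      exists (psat q m'); split; auto; reflexivity.
    + exists (S (S n3)), (psat (false :: q) m'); split; auto.
      exists (psat q m'); split; auto; reflexivity.
    + exists (S n1), (psat q m); split; auto; reflexivity.
Qed.

Lemma definable_AH R L : definable R -> (forall x, L x <-> R (scons x zenv)) -> AH L.
Proof.
  intros HR HL; apply definable_prenex in HR; destruct HR as [q [m Hm]].
  destruct (proj1 (psat_hierarchy q m)) as [n Hn].
  exists n; left; exists (psat q m); split; auto.
  intros x; now rewrite HL.
Qed.

Lemma fundef_teval t : fundef (fun e => teval e t).
Proof.
  induction t; simpl; definability.
  apply fundef_ext with (fun e => teval e t + 1); [intros; lia|definability].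
Qed.

Lemma definable_scons (R : env -> Prop) :
  definable R -> definable (fun e => R (scons (e 0) (fun i => e (S i)))).
Proof.
  apply definable_iff; intros e.
  replace (scons (e 0) (fun i => e (S i))) with e; [reflexivity|].
  extensionality i; destruct i; reflexivity.
Qed.

Lemma definable_d0sat p : definable (fun e => d0sat e p).
Proof.
  induction p as [t u|t u|p IH|p IH q IH'|p IH q IH'|t p IH|t p IH]; simpl;
    try pose proof (fundef_teval t); try pose proof (fundef_teval u).
  - now apply definable_eq.
  - now apply definable_le.
  - now apply definable_not.
  - now apply definable_and.
  - now apply definable_or.
  - apply (definable_all (fun x e => x < teval e t -> d0sat (scons x e) p)).
    apply definable_imp; [apply definable_lt; [apply fundef_var|]|].
    + exact (fundef_ren _ S H).
    + exact (definable_scons _ IH).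
  - apply (definable_ex (fun x e => x < teval e t /\ d0sat (scons x e) p)).
    apply definable_and; [apply definable_lt; [apply fundef_var|]|].
    + exact (fundef_ren _ S H).
    + exact (definable_scons _ IH).
Qed.

Lemma hierarchy_definable n : forall R, (Sigma n R -> definable R) /\ (Pi n R -> definable R).
Proof.
  induction n as [|n IH]; intros R.
  - split; intros [p Hp]; apply definable_iff with (1 := Hp); apply definable_d0sat.
  - split; intros [R' [H HR]]; apply definable_iff with (1 := HR).
    + apply (definable_ex (fun y e => R' (scons y e))), definable_scons, (proj2 (IH R')), H.
    + apply (definable_all (fun y e => R' (scons y e))), definable_scons, (proj1 (IH R')), H.
Qed.

Lemma AH_definable L : AH L -> exists p, forall x, L x <-> fosat (scons x zenv) p.
Proof.
  intros [n [[R [H HL]]|[R [H HL]]]]; apply hierarchy_definable in H;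
    destruct H as [p Hp]; exists p; intros x; now rewrite HL.
Qed.

(** * Bounded executions are definable *)

(** Results are compared bit by bit, and [fb] enters through its four fixed values. [Some] matches
    the shape of [eval_op] after simplification. *)
Lemma definable_bitop (op : nat -> nat -> nat) (fb : bool -> bool -> bool) :
  (forall a b i, Nat.testbit (op a b) i = fb (Nat.testbit a i) (Nat.testbit b i)) ->
  definable (fun e => Some (op (e 0) (e 1)) = Some (e 2)).
Proof.
  intros Hop.
  apply definable_iff with (fun e => forall i,
    (Nat.testbit (e 2) i = true <->
      ((fb true true = true /\ Nat.testbit (e 0) i = true /\ Nat.testbit (e 1) i = true) \/
       (fb true false = true /\ Nat.testbit (e 0) i = true /\ ~ Nat.testbit (e 1) i = true) \/
       (fb false true = true /\ ~ Nat.testbit (e 0) i = true /\ Nat.testbit (e 1) i = true) \/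
       (fb false false = true /\ ~ Nat.testbit (e 0) i = true /\ ~ Nat.testbit (e 1) i = true)))).
  - intros e; transitivity (op (e 0) (e 1) = e 2); [split; congruence|].
    split.
    + intros <- i; rewrite Hop.
      destruct (Nat.testbit (e 0) i), (Nat.testbit (e 1) i); intuition congruence.
    + intros H; apply Nat.bits_inj; intros i; specialize (H i); rewrite Hop.
      destruct (Nat.testbit (e 0) i), (Nat.testbit (e 1) i), (Nat.testbit (e 2) i);
      destruct (fb true true), (fb true false), (fb false true), (fb false false);
      intuition congruence.
  - apply definable_all.
    (* A proposition independent of [e] is classically true or false, hence equivalent to [0 = 0] or
       to [0 = 1]. *)
    assert (C : forall P : Prop, definable (fun _ => P)).
    { intros P; destruct (classic P).
      - apply definable_iff with (fun e => 0 = 0); [tauto|definability].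
      - apply definable_iff with (fun e => 0 = 1); [intros; split; [tauto|discriminate]|].
        definability. }
    repeat first [apply definable_equiv | apply definable_or | apply definable_and
      | apply (C (_ = true)) | apply definable_not
      | apply definable_testbit; apply fundef_var].
Qed.

Lemma definable_eval_op o : definable (fun e => eval_op o (e 0) (e 1) = Some (e 2)).
Proof.
  destruct o; simpl.
  - apply definable_iff with (fun e => e 0 + e 1 = e 2); [split; congruence|definability].
  - apply definable_iff with (fun e => ~ e 1 = 0 /\ e 1 * e 2 = e 0); [|definability].
    intros e; destruct (Nat.eqb_spec (e 1) 0) as [Z|Z]; simpl.
    + split; [discriminate|tauto].
    + destruct (Nat.eqb_spec (e 0 mod e 1) 0) as [M|M].
      * apply Nat.Div0.div_exact in M; split.
        -- intros [= <-]; auto.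
        -- intros [_ H]; f_equal; rewrite <- H, Nat.mul_comm; now apply Nat.div_mul.
      * split; [discriminate|]; intros [_ H]; contradict M.
        rewrite <- H, Nat.mul_comm; apply Nat.Div0.mod_mul.
  - pose proof (fundef_pow2 (fun e => e 1) (fundef_var 1)).
    apply definable_iff with (fun e => e 0 * 2 ^ e 1 = e 2); [split; congruence|definability].
  - exact (definable_bitop _ _ Nat.land_spec).
  - exact (definable_bitop _ _ Nat.lor_spec).
  - exact (definable_bitop _ _ Nat.lxor_spec).
Qed.

(** Totalised so that it can be a [fundef]; in symbolic runs it appears next to the condition that
    the operation is defined, so the default [0] never decides anything. *)
Definition opval (o : binop) (a b : nat) : nat :=
  match eval_op o a b with Some v => v | None => 0 end.

Lemma definable_eval_op_some o F G : fundef F -> fundef G ->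
  definable (fun e => exists v, eval_op o (F e) (G e) = Some v).
Proof.
  intros HF HG; apply definable_ex.
  apply (definable_subst3 (fun a b c => eval_op o a b = Some c));
    [definability..|apply definable_eval_op].
Qed.

Lemma fundef_opval o F G : fundef F -> fundef G -> fundef (fun e => opval o (F e) (G e)).
Proof.
  apply fundef_graph with
    (R := fun a b c => eval_op o a b = Some c \/ ((~ exists v, eval_op o a b = Some v) /\ c = 0)).
  - intros a b c; unfold opval; destruct (eval_op o a b) as [v|].
    + split; [intros [[= ->]|[H _]]; auto; contradict H; eauto|intros ->; auto].
    + split; [intros [H|[_ H]]; [discriminate|auto]|].
      intros ->; right; split; auto; intros [v Hv]; discriminate.
  - apply definable_or; [apply definable_eval_op|].
    apply definable_and; [|definability].
    apply definable_not, definable_eval_op_some; apply fundef_var.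
Qed.

(** Indirect addressing makes the register index depend on the environment. A symbolic register file
    must therefore allow lookup at every definable address, not just at fixed ones. *)
Definition regdef (rho : env -> regs) : Prop :=
  forall F, fundef F -> fundef (fun e => rho e (F e)).

Lemma regdef_upd rho F V : regdef rho -> fundef F -> fundef V ->
  regdef (fun e => upd (rho e) (F e) (V e)).
Proof.
  intros Hr HF HV G HG.
  apply (fundef_cases (fun e => G e = F e) V (fun e => rho e (G e))); auto.
  - now apply definable_eq.
  - intros e ->; apply upd_eq.
  - intros e H; now apply upd_neq.
Qed.

Definition accepts (s : status) : Prop := exists r, s = Halted r /\ r 0 <> 0.

Lemma not_accepts_stuck : ~ accepts Stuck.
Proof. intros [r [H _]]; discriminate. Qed.

Lemma accepts_halted r : accepts (Halted r) <-> r 0 <> 0.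
Proof.
  split; [intros [r' [[= ->] H]]; auto|intros H; exists r; auto].
Qed.

Lemma exec_stopped P A n s : stopped s -> exec P A n s = s.
Proof. destruct n, s; simpl; tauto. Qed.

(** Symbolic execution: program counter and number of calls stay concrete, only registers depend on
    [e]. A conditional jump splits the formula into two cases, so [n] steps unfold into a finite
    formula. *)
Lemma definable_accepts P (A : env -> nat -> nat) : (forall i, fundef (fun e => A e i)) ->
  forall n pc k rho, regdef rho ->
  definable (fun e => accepts (exec P (A e) n (Running (Cfg pc (rho e) k)))).
Proof.
  intros HA.
  assert (never : definable (fun _ => False)).
  { apply definable_iff with (fun e => 0 = 1); [intros; split; [tauto|discriminate]|].
    definability. }
  induction n as [|n IH]; intros pc k rho Hrho; simpl.
  { revert never; apply definable_iff; intros e; split; [|tauto].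
    intros [r [H _]]; discriminate. }
  assert (Hc : forall c, fundef (fun e => rho e c)) by (intros c; apply Hrho, fundef_const).
  assert (halt : definable (fun e => accepts (exec P (A e) n (Halted (rho e))))).
  { apply definable_iff with (fun e => ~ rho e 0 = 0).
    - intros e; rewrite exec_stopped by exact I; apply accepts_halted.
    - apply definable_not, definable_eq; [auto|apply fundef_const]. }
  unfold step; simpl; destruct (nth_error P pc) as [ins|]; [|exact halt].
  destruct ins as [i c|i j|i j|i j|o i j l|i j l| |i].
  - apply (IH (S pc) k (fun e => upd (rho e) i c)), regdef_upd; auto; apply fundef_const.
  - apply (IH (S pc) k (fun e => upd (rho e) i (rho e j))), regdef_upd; auto;
      apply fundef_const.
  - apply (IH (S pc) k (fun e => upd (rho e) i (rho e (rho e j)))), regdef_upd; auto;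
      apply fundef_const.
  - apply (IH (S pc) k (fun e => upd (rho e) (rho e i) (rho e j))), regdef_upd; auto.
  - apply definable_iff with (fun e => (exists v, eval_op o (rho e j) (rho e l) = Some v) /\
      accepts (exec P (A e) n (Running
        (Cfg (S pc) (upd (rho e) i (opval o (rho e j) (rho e l))) k)))).
    + intros e; unfold opval; destruct (eval_op o (rho e j) (rho e l)) as [v|].
      * split; [eauto|tauto].
      * rewrite exec_stopped by exact I; split.
        -- intros H; now apply not_accepts_stuck in H.
        -- intros [[v Hv] _]; discriminate.
    + apply definable_and; [now apply definable_eval_op_some|].
      apply (IH (S pc) k (fun e => upd (rho e) i (opval o (rho e j) (rho e l)))).
      apply regdef_upd; auto; [apply fundef_const|now apply fundef_opval].
  - apply definable_iff with (fun e =>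
      (rho e i = rho e j /\ accepts (exec P (A e) n (Running (Cfg l (rho e) k)))) \/
      (~ rho e i = rho e j /\ accepts (exec P (A e) n (Running (Cfg (S pc) (rho e) k))))).
    + intros e; destruct (Nat.eqb_spec (rho e i) (rho e j)); tauto.
    + pose proof (definable_eq _ _ (Hc i) (Hc j)).
      apply definable_or; apply definable_and; auto; now apply definable_not.
  - exact halt.
  - apply (IH (S pc) (S k) (fun e => upd (rho e) i (A e k))), regdef_upd; auto;
      apply fundef_const.
Qed.

Lemma definable_almost (Q : nat -> (nat -> nat) -> Prop) :
  (forall I A, fundef I -> (forall i, fundef (fun e => A e i)) ->
    definable (fun e => Q (I e) (A e))) ->
  forall r k I A, fundef I -> (forall i, fundef (fun e => A e i)) ->
  definable (fun e => almost k r (A e) (Q (I e))).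
Proof.
  intros HQ; induction r as [|r IH]; intros k I A HI HA; simpl; [now apply HQ|].
  apply definable_ex, definable_all, definable_imp; [definability|]; cbv beta.
  apply (IH (S k) (fun e => I (fun i => e (S (S i))))
    (fun e => upd (A (fun i => e (S (S i)))) k (e 0))); [definability|].
  intros i; unfold upd; destruct (Nat.eqb i k); [apply fundef_var|].
  exact (fundef_ren (fun e => A e i) (fun i => S (S i)) (HA i)).
Qed.

Lemma exec_agree P m : forall n A B c, agree m A B -> nalns c + n <= m ->
  exec P A n (Running c) = exec P B n (Running c).
Proof.
  induction n as [|n IH]; intros A B c H Hc; [reflexivity|].
  simpl; assert (E : step P A c = step P B c).
  { unfold step; destruct (nth_error P (pc c)) as [[]|]; auto.
    rewrite (H (nalns c)) by lia; reflexivity. }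
  rewrite E; destruct (step P B c) as [c'| |] eqn:Hs.
  - apply IH; auto.
    enough (nalns c' <= S (nalns c)) by lia.
    unfold step in Hs.
    destruct (nth_error P (pc c)) as [[]|]; try discriminate;
      try (injection Hs as <-; simpl; lia).
    + destruct (eval_op _ _ _); [|discriminate]; injection Hs as <-; simpl; lia.
    + destruct (Nat.eqb _ _); injection Hs as <-; simpl; lia.
  - now rewrite !exec_stopped by exact I.
  - now rewrite !exec_stopped by exact I.
Qed.

Lemma exec_add P A a : forall b s, exec P A (a + b) s = exec P A b (exec P A a s).
Proof.
  induction a as [|a IH]; intros b s; [reflexivity|].
  simpl; destruct s; auto; now rewrite exec_stopped by exact I.
Qed.

Lemma exec_halted_stopped P A n T s r : exec P A n s = Halted r ->
  stopped (exec P A T s) -> exec P A T s = Halted r.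
Proof.
  intros Hn HT.
  rewrite <- (exec_stopped P A n (exec P A T s) HT), <- exec_add, Nat.add_comm, exec_add, Hn.
  now apply exec_stopped.
Qed.

(** The ALS set depends on the input and is not arithmetically described, but the [almost] statement
    does not mention it. If [f inp = 0], rejection holds almost everywhere, which excludes
    acceptance almost everywhere. *)
Lemma O1_ASRAM_AH L : O1_ASRAM_language L -> AH L.
Proof.
  intros [P [[f [Hf HL]] [T HT]]].
  set (Q := fun inp A => accepts (exec P A T (init inp))).
  assert (FQ : forall inp, finitary T (Q inp)).
  { intros inp A B HAB; unfold Q, init.
    rewrite (exec_agree P T T A B); auto. }
  assert (FN : forall inp, finitary T (fun A => ~ Q inp A)).
  { intros inp A B HAB H HB; apply H; apply (FQ inp B); auto; now apply agree_sym. }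
  apply (definable_AH (fun e => almost 0 T (fun _ => 0) (Q (e 0)))).
  - apply (definable_almost Q) with (I := fun e => e 0) (A := fun _ _ => 0).
    + intros I A HI HA.
      apply (definable_accepts P A HA T 0 0 (fun e x => if Nat.eqb x 0 then I e else 0)).
      intros F HF.
      apply (fundef_cases (fun e => F e = 0) I (fun _ => 0)); auto.
      * definability.
      * apply fundef_const.
      * intros e ->; reflexivity.
      * intros e H; now apply Nat.eqb_neq in H as ->.
    + apply fundef_var.
    + intros; apply fundef_const.
  - intros inp; rewrite <- HL; simpl.
    destruct (Hf inp) as [S [HS Hcomp]].
    assert (Hrun : forall A, S A -> Q inp A <-> f inp <> 0).
    { intros A HA; destruct (Hcomp A HA) as [n [r [Hn Hr]]].
      unfold Q; rewrite (exec_halted_stopped P A n T _ r); auto.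
      rewrite accepts_halted, Hr; reflexivity. }
    split.
    + intros H; apply (ALS_almost S); auto; intros A HA; now apply Hrun.
    + intros H Hz.
      assert (H' : almost 0 T (fun _ => 0) (fun A => ~ Q inp A)).
      { apply (ALS_almost S); auto; intros A HA; rewrite Hrun; auto. }
      destruct (almost_inhabited _ _ _ _ (almost_and _ _ _ _ _ H H')); tauto.
Qed.

(** * Digit sums *)

Fixpoint sumn (f : nat -> nat) (N : nat) : nat :=
  match N with O => 0 | S m => sumn f m + f m end.

Lemma sumn_ext f g N : (forall x, x < N -> f x = g x) -> sumn f N = sumn g N.
Proof.
  induction N as [|N IH]; simpl; intros H; [reflexivity|].
  rewrite IH, H; auto.
Qed.

Lemma sumn_add f g N : sumn (fun x => f x + g x) N = sumn f N + sumn g N.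
Proof. induction N as [|N IH]; simpl; [reflexivity|]; rewrite IH; lia. Qed.

Lemma sumn_scale c f N : sumn (fun x => c * f x) N = c * sumn f N.
Proof. induction N as [|N IH]; simpl; [lia|]; rewrite IH; lia. Qed.

Lemma sumn_pos f N : 0 < sumn f N <-> exists x, x < N /\ 0 < f x.
Proof.
  induction N as [|N IH]; simpl.
  - split; [lia|intros [x [H _]]; lia].
  - split.
    + intros H; destruct (Nat.eq_dec (f N) 0) as [Hz|Hz].
      * destruct (proj1 IH) as [x [Hx Hf]]; [lia|]; exists x; auto.
      * exists N; lia.
    + intros [x [Hx Hf]]; destruct (Nat.eq_dec x N) as [->|]; [lia|].
      enough (0 < sumn f N) by lia; apply IH; exists x; split; [lia|auto].
Qed.

Lemma sumn_single f N y : y < N -> (forall x, x <> y -> f x = 0) -> sumn f N = f y.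
Proof.
  intros Hy H; induction N as [|N IH]; [lia|]; simpl.
  destruct (Nat.eq_dec y N) as [->|Hne].
  - enough (sumn f N = 0) by lia.
    destruct (Nat.eq_dec (sumn f N) 0) as [|Hz]; auto.
    destruct (proj1 (sumn_pos f N)) as [x [Hx Hf]]; [lia|]; rewrite H in Hf; lia.
  - rewrite IH by lia; rewrite (H N); auto.
Qed.

Lemma sumn_geometric P c N :
  sumn (fun x => P * (1 + c) ^ x) N * c + P = P * (1 + c) ^ N.
Proof.
  induction N as [|N IH]; [simpl; lia|].
  rewrite Nat.pow_succ_r'; cbn [sumn]; nia.
Qed.

(** Summation by parts, kept free of subtraction. With base [1 + c], the sum becomes an exact
    quotient by [c]; it is the table of the variable itself. *)
Lemma sumn_moment P c N :
  sumn (fun x => x * P * (1 + c) ^ x) N * c + (1 + c) * sumn (fun x => P * (1 + c) ^ x) N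
  = N * P * (1 + c) ^ N.
Proof.
  induction N as [|N IH]; [simpl; lia|].
  rewrite Nat.pow_succ_r'; cbn [sumn]; nia.
Qed.

Lemma sumn_digits_lt a B N : (forall x, x < N -> a x < B) ->
  sumn (fun x => a x * B ^ x) N < B ^ N.
Proof.
  induction N as [|N IH]; intros H; [simpl; lia|].
  rewrite Nat.pow_succ_r'; cbn [sumn].
  assert (a N < B) by auto; assert (sumn (fun x => a x * B ^ x) N < B ^ N) by auto.
  nia.
Qed.

(** [fb false false = false] keeps leading zeros of both operands zero, so that a result fits into
    the width of its operands. *)
Definition bitwise (op : nat -> nat -> nat) : Prop := exists fb, fb false false = false /\
  forall a b i, Nat.testbit (op a b) i = fb (Nat.testbit a i) (Nat.testbit b i).

Lemma bitwise_land : bitwise Nat.land.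
Proof. exists andb; split; auto; apply Nat.land_spec. Qed.

Lemma bitwise_lxor : bitwise Nat.lxor.
Proof. exists xorb; split; auto; apply Nat.lxor_spec. Qed.

Lemma pow2_pos k : 0 < 2 ^ k.
Proof. apply Nat.neq_0_lt_0, Nat.pow_nonzero; lia. Qed.

Lemma testbit_split k low a i : low < 2 ^ k ->
  Nat.testbit (low + a * 2 ^ k) i =
  if i <? k then Nat.testbit low i else Nat.testbit a (i - k).
Proof.
  intros H; pose proof (pow2_pos k).
  destruct (Nat.ltb_spec i k) as [Hi|Hi].
  - rewrite <- (Nat.mod_pow2_bits_low _ k) by auto.
    now rewrite Nat.Div0.mod_add, Nat.mod_small.
  - replace i with (i - k + k) at 1 by lia.
    rewrite <- Nat.div_pow2_bits, Nat.div_add, Nat.div_small by lia; reflexivity.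
Qed.

Lemma lt_pow2_bits a k : (forall i, k <= i -> Nat.testbit a i = false) -> a < 2 ^ k.
Proof.
  intros H; replace a with (a mod 2 ^ k).
  - apply Nat.mod_upper_bound; pose proof (pow2_pos k); lia.
  - apply Nat.bits_inj; intros i; destruct (le_lt_dec k i).
    + rewrite Nat.mod_pow2_bits_high, H; auto.
    + now rewrite Nat.mod_pow2_bits_low.
Qed.

Lemma bits_lt_pow2 a k i : a < 2 ^ k -> k <= i -> Nat.testbit a i = false.
Proof.
  intros H Hi; rewrite <- (Nat.mod_small a (2 ^ k)) by auto.
  now apply Nat.mod_pow2_bits_high.
Qed.

Lemma bitwise_lt op k a b : bitwise op -> a < 2 ^ k -> b < 2 ^ k -> op a b < 2 ^ k.
Proof.
  intros [fb [H0 Hop]] Ha Hb; apply lt_pow2_bits; intros i Hi.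
  now rewrite Hop, (bits_lt_pow2 a k), (bits_lt_pow2 b k).
Qed.

Lemma bitwise_split op k low low' a b : bitwise op -> low < 2 ^ k -> low' < 2 ^ k ->
  op (low + a * 2 ^ k) (low' + b * 2 ^ k) = op low low' + op a b * 2 ^ k.
Proof.
  intros Hb H H'; pose proof (bitwise_lt op k low low' Hb H H').
  destruct Hb as [fb [_ Hop]]; apply Nat.bits_inj; intros i.
  rewrite Hop, !testbit_split by auto.
  destruct (i <? k); now rewrite Hop.
Qed.

Lemma bitwise_sumn op a b w N : bitwise op ->
  (forall x, x < N -> a x < 2 ^ w) -> (forall x, x < N -> b x < 2 ^ w) ->
  op (sumn (fun x => a x * (2 ^ w) ^ x) N) (sumn (fun x => b x * (2 ^ w) ^ x) N)
  = sumn (fun x => op (a x) (b x) * (2 ^ w) ^ x) N.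
Proof.
  intros Hop; induction N as [|N IH]; intros Ha Hb; simpl.
  - destruct Hop as [fb [H0 Hop]]; apply Nat.bits_inj; intros i.
    now rewrite Hop, Nat.bits_0.
  - rewrite <- IH by auto; rewrite <- Nat.pow_mul_r.
    apply bitwise_split; auto; rewrite Nat.pow_mul_r; apply sumn_digits_lt; auto.
Qed.

Lemma land_pow2 v k : v < 2 ^ (k + 1) ->
  Nat.land v (2 ^ k) = Nat.b2n (2 ^ k <=? v) * 2 ^ k.
Proof.
  intros H; rewrite Nat.add_1_r, Nat.pow_succ_r' in H; pose proof (pow2_pos k).
  set (a := Nat.b2n (2 ^ k <=? v)).
  assert (Hv : v = (v - a * 2 ^ k) + a * 2 ^ k /\ v - a * 2 ^ k < 2 ^ k).
  { unfold a; destruct (Nat.leb_spec (2 ^ k) v); simpl; lia. }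
  destruct Hv as [Hv Hl]; rewrite Hv at 1.
  replace (2 ^ k) with (0 + 1 * 2 ^ k) at 3 by lia.
  rewrite bitwise_split; auto using bitwise_land.
  rewrite Nat.land_0_r; unfold a; destruct (2 ^ k <=? v); reflexivity.
Qed.

(** * Tables of functions on a box *)

(* A function on the box [x_l < 2 ^ n l, ..., x_(l+c-1) < 2 ^ n (l+c-1)] is stored as the
   sum of its values, the digit of [x_j] having weight [2 ^ (2 ^ u (j+1))]. The bound
   variables are pushed on the environment, so [x_(l+c-1)] gets index [0]. *)
Fixpoint tab (n u : nat -> nat) (l c : nat) (e : env) (F : env -> nat) : nat :=
  match c with
  | O => F e
  | S c' => sumn (fun x => tab n u (S l) c' (scons x e) F * (2 ^ (2 ^ u (S l))) ^ x) (2 ^ n l)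
  end.

Fixpoint inbox (n : nat -> nat) (l c : nat) (e e' : env) : Prop :=
  match c with
  | O => e' = e
  | S c' => exists x, x < 2 ^ n l /\ inbox n (S l) c' (scons x e) e'
  end.

(** A level holds [2 ^ n l] digits of [2 ^ u (S l)] bits each; the extra [1] doubles the room and so
    admits a carry bit. *)
Definition spaced (n u : nat -> nat) (D : nat) : Prop :=
  forall l, l < D -> u (S l) + n l + 1 <= u l.

Lemma inbox_outer n c : forall l e e' i, inbox n l c e e' -> e' (c + i) = e i.
Proof.
  induction c as [|c IH]; simpl; intros l e e' i; [now intros ->|].
  intros [x [_ H]]; replace (S (c + i)) with (c + S i) by lia.
  now rewrite (IH _ _ _ _ H).
Qed.

Lemma inbox_lt n D h c : (forall l, l < D -> n l <= h) -> forall l e e', l + c <= D ->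
  (forall i, e i < 2 ^ h) -> inbox n l c e e' -> forall i, e' i < 2 ^ h.
Proof.
  intros Hn; induction c as [|c IH]; simpl; intros l e e' Hl He; [now intros ->|].
  intros [x [Hx H]]; apply (IH (S l) (scons x e) e'); auto; [lia|].
  intros [|i]; simpl; auto.
  apply Nat.lt_le_trans with (1 := Hx), Nat.pow_le_mono_r; [lia|apply Hn; lia].
Qed.

Lemma tab_S n u l c e F : tab n u l (S c) e F =
  sumn (fun x => tab n u (S l) c (scons x e) F * (2 ^ (2 ^ u (S l))) ^ x) (2 ^ n l).
Proof. reflexivity. Qed.

Lemma tab_ext n u c : forall l e F G, (forall e', inbox n l c e e' -> F e' = G e') ->
  tab n u l c e F = tab n u l c e G.
Proof.
  induction c as [|c IH]; simpl; intros l e F G H; [auto|].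
  apply sumn_ext; intros x Hx; f_equal; apply IH; intros e' He'; apply H; eauto.
Qed.

Lemma tab_add n u c : forall l e F G,
  tab n u l c e (fun e' => F e' + G e') = tab n u l c e F + tab n u l c e G.
Proof.
  induction c as [|c IH]; simpl; intros l e F G; [auto|].
  rewrite <- sumn_add; apply sumn_ext; intros x Hx; rewrite IH; ring.
Qed.

Lemma tab_scale n u k c : forall l e F,
  tab n u l c e (fun e' => k * F e') = k * tab n u l c e F.
Proof.
  induction c as [|c IH]; simpl; intros l e F; [auto|].
  rewrite <- sumn_scale; apply sumn_ext; intros x Hx; rewrite IH; ring.
Qed.

(** The innermost coordinate becomes part of the entry: each entry is now a whole row. An
    existential quantifier thus becomes the test whether a row of truth values is nonzero. *)
Lemma tab_last n u c : forall l e F, tab n u l (S c) e F =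
  tab n u l c e (fun e' => sumn (fun x =>
    F (scons x e') * (2 ^ (2 ^ u (S (l + c)))) ^ x) (2 ^ n (l + c))).
Proof.
  induction c as [|c IH]; intros l e F.
  - simpl; now rewrite Nat.add_0_r.
  - rewrite tab_S; rewrite (tab_S n u l c); apply sumn_ext; intros x Hx.
    now rewrite IH, Nat.add_succ_comm.
Qed.

Lemma tab_lt n u D c : spaced n u D -> forall l e F, l + c <= D ->
  (forall e', inbox n l c e e' -> F e' < 2 ^ (2 ^ u (l + c))) ->
  tab n u l c e F < 2 ^ (2 ^ u l).
Proof.
  intros Hsp; induction c as [|c IH]; simpl; intros l e F Hl H.
  - rewrite Nat.add_0_r in H; auto.
  - apply Nat.lt_le_trans with ((2 ^ (2 ^ u (S l))) ^ (2 ^ n l)).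
    + apply sumn_digits_lt; intros x Hx; apply IH; [lia|].
      intros e' He'; rewrite Nat.add_succ_comm; apply H; eauto.
    + rewrite <- Nat.pow_mul_r, <- Nat.pow_add_r.
      apply Nat.pow_le_mono_r; [lia|]; apply Nat.pow_le_mono_r; [lia|].
      specialize (Hsp l); lia.
Qed.

Lemma tab_bitwise n u D op c : spaced n u D -> bitwise op -> forall l e F G, l + c <= D ->
  (forall e', inbox n l c e e' -> F e' < 2 ^ (2 ^ u (l + c))) ->
  (forall e', inbox n l c e e' -> G e' < 2 ^ (2 ^ u (l + c))) ->
  op (tab n u l c e F) (tab n u l c e G) = tab n u l c e (fun e' => op (F e') (G e')).
Proof.
  intros Hsp Hop; induction c as [|c IH]; simpl; intros l e F G Hl HF HG; [auto|].
  rewrite bitwise_sumn; auto.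
  - apply sumn_ext; intros x Hx; f_equal; apply IH; [lia|..];
      intros e' He'; rewrite Nat.add_succ_comm; eauto.
  - intros x Hx; apply (tab_lt n u D); auto; [lia|].
    intros e' He'; rewrite Nat.add_succ_comm; eauto.
  - intros x Hx; apply (tab_lt n u D); auto; [lia|].
    intros e' He'; rewrite Nat.add_succ_comm; eauto.
Qed.

(** A squarefree monomial factors by variable, so its table can be built one coordinate at a
    time. *)
Fixpoint mono (b : nat -> bool) (c : nat) (e : env) : nat :=
  match c with
  | O => 1
  | S k => (if b k then e k else 1) * mono b k e
  end.

Lemma mono_none b c e : (forall k, k < c -> b k = false) -> mono b c e = 1.
Proof.
  induction c as [|c IH]; simpl; intros H; [reflexivity|].
  rewrite H, IH by auto; reflexivity.
Qed.

Lemma mono_var i c e : i < c -> mono (Nat.eqb i) c e = e i.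
Proof.
  intros H; induction c as [|c IH]; [lia|]; simpl.
  destruct (Nat.eqb_spec i c) as [->|].
  - rewrite mono_none; [lia|]; intros k Hk; apply Nat.eqb_neq; lia.
  - rewrite IH; lia.
Qed.

Lemma mono_two c e : 1 < c -> mono (fun k => k <? 2) c e = e 0 * e 1.
Proof.
  intros H; induction H as [|c H IH]; [simpl; lia|].
  change (mono (fun k => k <? 2) (S c) e) with
    ((if c <? 2 then e c else 1) * mono (fun k => k <? 2) c e).
  destruct (Nat.ltb_spec c 2); lia.
Qed.

(** * Expressions over the instruction set *)

Inductive expr : Type :=
| EReg (i : nat)
| ECst (c : nat)
| EOp (o : binop) (x y : expr).

Fixpoint ev (rho : regs) (x : expr) : option nat :=
  match x with
  | EReg i => Some (rho i)
  | ECst c => Some c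
  | EOp o x y =>
      match ev rho x, ev rho y with
      | Some a, Some b => eval_op o a b
      | _, _ => None
      end
  end.

Definition EPow (x : expr) : expr := EOp OShl (ECst 1) x.

Lemma ev_op rho o x y a b : ev rho x = Some a -> ev rho y = Some b ->
  ev rho (EOp o x y) = eval_op o a b.
Proof. simpl; now intros -> ->. Qed.

Lemma ev_div rho x y a b : ev rho x = Some (a * b) -> ev rho y = Some b -> b <> 0 ->
  ev rho (EOp ODiv x y) = Some a.
Proof.
  intros Hx Hy Hb; rewrite (ev_op rho ODiv x y _ _ Hx Hy); simpl.
  apply Nat.eqb_neq in Hb as Hb'; rewrite Hb', Nat.Div0.mod_mul; simpl.
  now rewrite Nat.div_mul.
Qed.

Lemma ev_pow rho x a : ev rho x = Some a -> ev rho (EPow x) = Some (2 ^ a).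
Proof. intros H; simpl; rewrite H; f_equal; lia. Qed.

(* [(4 ^ a + 2) / 3] is [0101...0110] in binary; xor with [3] turns it into [0101...01],
   a third of [4 ^ a - 1]. *)
Definition EOnes (x : expr) : expr :=
  let t := EOp OXor (EOp ODiv (EOp OAdd (EPow (EOp OAdd x x)) (ECst 2)) (ECst 3)) (ECst 3) in
  EOp OAdd t (EOp OAdd t t).

Lemma ev_ones rho x a : ev rho x = Some (S a) ->
  ev rho (EOnes x) = Some (Nat.ones (S a + S a)).
Proof.
  intros Hx.
  (* With [4 ^ a = 3 q + 1] the quotient in [EOnes] at [a + 1] is [4 q + 2]; its low bits [10]
     become [01], and [3 (4 q + 1) = 4 ^ (a + 1) - 1]. At exponent [0] the quotient is [1], with
     other low bits, hence the successor. *)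
  assert (Hq : exists q, 2 ^ (a + a) = 3 * q + 1).
  { clear Hx; induction a as [|a [q IH]]; [exists 0; reflexivity|].
    exists (4 * q + 1); replace (S a + S a) with (S (S (a + a))) by lia.
    rewrite !Nat.pow_succ_r', IH; lia. }
  destruct Hq as [q Hq].
  assert (E : 2 ^ (S a + S a) = 12 * q + 4).
  { replace (S a + S a) with (S (S (a + a))) by lia; rewrite !Nat.pow_succ_r', Hq; lia. }
  set (s := EOp ODiv (EOp OAdd (EPow (EOp OAdd x x)) (ECst 2)) (ECst 3)).
  assert (Hs : ev rho s = Some (2 + q * 2 ^ 2)).
  { apply ev_div with 3; [|reflexivity|lia].
    rewrite (ev_op rho OAdd _ _ (2 ^ (S a + S a)) 2); [| |reflexivity].
    { unfold eval_op; rewrite E; f_equal; simpl; lia. }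
    apply ev_pow; now rewrite (ev_op rho OAdd x x _ _ Hx Hx). }
  assert (Ht : ev rho (EOp OXor s (ECst 3)) = Some (1 + q * 2 ^ 2)).
  { rewrite (ev_op rho OXor s (ECst 3) _ 3 Hs eq_refl); simpl eval_op; f_equal.
    transitivity (Nat.lxor (2 + q * 2 ^ 2) (3 + 0 * 2 ^ 2)); [reflexivity|].
    rewrite (bitwise_split _ _ _ _ _ _ bitwise_lxor) by (simpl; lia).
    now rewrite Nat.lxor_0_r. }
  unfold EOnes; fold s.
  rewrite (ev_op _ _ _ _ _ _ Ht (ev_op _ OAdd _ _ _ _ Ht Ht)); simpl eval_op; f_equal.
  rewrite Nat.ones_equiv, E; simpl; lia.
Qed.

(* Subtraction through the complement of [y] with respect to [2 * (x + 1)] bits. *)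
Definition ESub (x y : expr) : expr :=
  let m := EOnes (EOp OAdd x (ECst 1)) in
  EOp OAnd (EOp OAdd (EOp OAdd x (EOp OXor y m)) (ECst 1)) m.

Lemma ev_sub rho x y a b : ev rho x = Some a -> ev rho y = Some b -> b <= a ->
  ev rho (ESub x y) = Some (a - b).
Proof.
  intros Hx Hy Hab.
  set (k := S a + S a).
  assert (Hk : a < 2 ^ k).
  { apply Nat.lt_le_trans with (2 ^ a); [apply Nat.pow_gt_lin_r; lia|].
    apply Nat.pow_le_mono_r; unfold k; lia. }
  assert (Hm : ev rho (EOnes (EOp OAdd x (ECst 1))) = Some (Nat.ones k)).
  { apply ev_ones; rewrite (ev_op rho OAdd x (ECst 1) _ 1 Hx eq_refl).
    simpl; f_equal; lia. }
  assert (Hc : Nat.lxor b (Nat.ones k) = 2 ^ k - 1 - b).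
  { change (Nat.lxor b (Nat.ones k)) with (Nat.lnot b k).
    enough (b + Nat.lnot b k = 2 ^ k - 1) by lia.
    destruct (Nat.eq_dec b 0) as [->|Hb].
    - rewrite Nat.lnot_0_l, Nat.ones_equiv; lia.
    - rewrite Nat.add_lnot_diag_low, Nat.ones_equiv; [lia|].
      apply Nat.log2_lt_pow2; lia. }
  unfold ESub.
  rewrite (ev_op _ OAnd _ _ (a + (2 ^ k - 1 - b) + 1) _) with (2 := Hm).
  - cbn [eval_op]; f_equal; rewrite Nat.land_ones.
    replace (a + (2 ^ k - 1 - b) + 1) with (a - b + 1 * 2 ^ k) by lia.
    rewrite Nat.Div0.mod_add, Nat.mod_small; lia.
  - rewrite (ev_op _ OAdd _ _ (a + (2 ^ k - 1 - b)) 1); auto.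
    rewrite (ev_op _ OAdd _ _ a (2 ^ k - 1 - b)); auto.
    rewrite (ev_op _ OXor _ _ _ _ Hy Hm); cbn [eval_op]; now rewrite Hc.
Qed.

(** [(P B ^ N - P) / (B - 1)] with [B = 2 ^ 2 ^ s] and [N = 2 ^ n], where
    [B ^ N = 2 ^ 2 ^ (s + n)]. *)
Definition EGeom (p s n : expr) : expr :=
  EOp ODiv (ESub (EOp OShl p (EPow (EOp OAdd s n))) p) (ESub (EPow (EPow s)) (ECst 1)).

(** [(N P B ^ N - B G) / (B - 1)] with [G] the geometric sum, as given by [sumn_moment]. *)
Definition EMoment (p s n : expr) : expr :=
  EOp ODiv
    (ESub (EOp OShl (EOp OShl p (EPow (EOp OAdd s n))) n) (EOp OShl (EGeom p s n) (EPow s)))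
    (ESub (EPow (EPow s)) (ECst 1)).

Lemma ev_pow_pred rho x s : ev rho x = Some s ->
  ev rho (ESub (EPow (EPow x)) (ECst 1)) = Some (2 ^ 2 ^ s - 1).
Proof.
  intros H; apply ev_sub; [now apply ev_pow, ev_pow|reflexivity|].
  apply (pow2_pos (2 ^ s)).
Qed.

Lemma pow_pow_gt_1 s : 1 < 2 ^ 2 ^ s.
Proof.
  apply Nat.lt_le_trans with (2 ^ 1); [simpl; lia|].
  apply Nat.pow_le_mono_r; [lia|apply (pow2_pos s)].
Qed.

Lemma ev_shl_box rho p x y P s n : ev rho p = Some P -> ev rho x = Some s ->
  ev rho y = Some n ->
  ev rho (EOp OShl p (EPow (EOp OAdd x y))) = Some (P * (2 ^ 2 ^ s) ^ 2 ^ n).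
Proof.
  intros Hp Hx Hy; rewrite (ev_op _ OShl _ _ P (2 ^ (s + n)) Hp).
  - cbn [eval_op]; f_equal; f_equal; rewrite Nat.pow_add_r; apply Nat.pow_mul_r.
  - apply ev_pow; now rewrite (ev_op _ OAdd _ _ _ _ Hx Hy).
Qed.

Lemma ev_geom rho p x y P s n : ev rho p = Some P -> ev rho x = Some s ->
  ev rho y = Some n ->
  ev rho (EGeom p x y) = Some (sumn (fun i => P * (2 ^ 2 ^ s) ^ i) (2 ^ n)).
Proof.
  intros Hp Hx Hy; pose proof (pow_pow_gt_1 s) as HB.
  apply ev_div with (2 ^ 2 ^ s - 1); [|now apply ev_pow_pred|lia].
  pose proof (sumn_geometric P (2 ^ 2 ^ s - 1) (2 ^ n)) as E.
  replace (1 + (2 ^ 2 ^ s - 1)) with (2 ^ 2 ^ s) in E by lia.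
  rewrite (ev_sub rho _ _ (P * (2 ^ 2 ^ s) ^ 2 ^ n) P);
    [|now apply ev_shl_box|auto|rewrite <- E; apply Nat.le_add_l].
  now rewrite <- E, Nat.add_sub.
Qed.

Lemma ev_moment rho p x y P s n : ev rho p = Some P -> ev rho x = Some s ->
  ev rho y = Some n ->
  ev rho (EMoment p x y) = Some (sumn (fun i => i * P * (2 ^ 2 ^ s) ^ i) (2 ^ n)).
Proof.
  intros Hp Hx Hy; pose proof (pow_pow_gt_1 s) as HB.
  apply ev_div with (2 ^ 2 ^ s - 1); [|now apply ev_pow_pred|lia].
  pose proof (sumn_moment P (2 ^ 2 ^ s - 1) (2 ^ n)) as E.
  replace (1 + (2 ^ 2 ^ s - 1)) with (2 ^ 2 ^ s) in E by lia.
  set (G := sumn (fun i => P * (2 ^ 2 ^ s) ^ i) (2 ^ n)) in *.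
  rewrite (ev_sub rho _ _ (P * (2 ^ 2 ^ s) ^ 2 ^ n * 2 ^ n) (G * 2 ^ 2 ^ s)).
  - replace (P * (2 ^ 2 ^ s) ^ 2 ^ n * 2 ^ n) with (2 ^ n * P * (2 ^ 2 ^ s) ^ 2 ^ n) by ring.
    now rewrite <- E, (Nat.mul_comm G), Nat.add_sub.
  - now rewrite (ev_op _ OShl _ _ _ _ (ev_shl_box _ _ _ _ _ _ _ Hp Hx Hy) Hy).
  - now rewrite (ev_op _ OShl _ _ _ _ (ev_geom _ _ _ _ _ _ _ Hp Hx Hy) (ev_pow _ _ _ Hx)).
  - replace (P * (2 ^ 2 ^ s) ^ 2 ^ n * 2 ^ n) with (2 ^ n * P * (2 ^ 2 ^ s) ^ 2 ^ n) by ring.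
    rewrite <- E, (Nat.mul_comm G); apply Nat.le_add_l.
Qed.

(** * Computing tables of formulas *)

(* Register [l + 1] holds the [l]-th arbitrary large number [A l]; for [l < D] it bounds
   the variable of level [l] by [2 ^ A l], and [A D] sets the width of the entries. *)
Fixpoint stride (A : nat -> nat) (D m : nat) : nat :=
  match m with
  | O => A D + 1
  | S m' => stride A D m' + A (D - m) + 1
  end.

Fixpoint EStride (D m : nat) : expr :=
  match m with
  | O => EOp OAdd (EReg (S D)) (ECst 1)
  | S m' => EOp OAdd (EOp OAdd (EStride D m') (EReg (S (D - m)))) (ECst 1)
  end.

(** Widths accumulate from level [D] outwards, hence the recursion on [D - l]. The [1] added at each
    stage leaves room for the carry of [ENonzero]. *)
Definition level (A : nat -> nat) (D l : nat) : nat := stride A D (D - l).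
Definition ELevel (D l : nat) : expr := EStride D (D - l).

Definition loaded (rho : regs) (A : nat -> nat) (D : nat) : Prop :=
  forall l, l <= D -> rho (S l) = A l.

Lemma ev_level rho A D l : loaded rho A D -> ev rho (ELevel D l) = Some (level A D l).
Proof.
  intros H; unfold ELevel, level.
  generalize (D - l) as m; intros m; induction m as [|m IH]; simpl.
  - now rewrite H.
  - rewrite IH, H by lia; reflexivity.
Qed.

Lemma level_spaced A D : spaced A (level A D) D.
Proof.
  intros l Hl; unfold level; replace (D - l) with (S (D - S l)) by lia; simpl.
  replace (D - S (D - S l)) with l by lia; lia.
Qed.

Lemma level_ge A D l : A D + 1 <= level A D l.
Proof.
  unfold level; generalize (D - l) as m; induction m as [|m IH]; simpl; lia.
Qed.

(** Of [c] remaining coordinates the outermost has index [c - 1], hence the test of [b] at [c']. *)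
Fixpoint EMono (D : nat) (b : nat -> bool) (x : expr) (l c : nat) : expr :=
  match c with
  | O => x
  | S c' => (if b c' then EMoment else EGeom)
              (EMono D b x (S l) c') (ELevel D (S l)) (EReg (S l))
  end.

Lemma ev_mono rho A D b x v : loaded rho A D -> ev rho x = Some v -> forall c l e,
  l + c <= D ->
  ev rho (EMono D b x l c) = Some (tab A (level A D) l c e (fun e' => v * mono b c e')).
Proof.
  intros HA Hx; induction c as [|c IH]; intros l e Hl.
  - simpl; rewrite Hx; f_equal; lia.
  - rewrite tab_S; simpl EMono.
    assert (IH' := fun e => IH (S l) e ltac:(lia)).
    set (P := tab A (level A D) (S l) c zenv (fun e' => v * mono b c e')) in *.
    assert (HPz : ev rho (EMono D b x (S l) c) = Some P) by apply IH'.
    (* The compiled expression does not mention the environment, so its single value shows that the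
       inner table is the same for all environments. *)
    assert (HP : forall e, tab A (level A D) (S l) c e (fun e' => v * mono b c e') = P).
    { intros e'; pose proof (IH' e') as H1; rewrite HPz in H1; congruence. }
    assert (Hr : ev rho (EReg (S l)) = Some (A l)) by (simpl; rewrite HA; auto; lia).
    destruct (b c) eqn:Hb.
    + rewrite (ev_moment _ _ _ _ _ _ _ HPz (ev_level _ _ _ (S l) HA) Hr).
      f_equal; apply sumn_ext; intros i Hi; f_equal.
      rewrite <- (HP (scons i e)), <- tab_scale; apply tab_ext; intros e' He'.
      simpl; rewrite Hb.
      replace (e' c) with i; [ring|].
      pose proof (inbox_outer _ _ _ _ _ 0 He') as H0; now rewrite Nat.add_0_r in H0.
    + rewrite (ev_geom _ _ _ _ _ _ _ HPz (ev_level _ _ _ (S l) HA) Hr).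
      f_equal; apply sumn_ext; intros i Hi; f_equal.
      rewrite <- (HP (scons i e)); apply tab_ext; intros e' He'.
      simpl; rewrite Hb; ring.
Qed.

Definition table (A : nat -> nat) (D d : nat) (F : env -> nat) : nat :=
  tab A (level A D) 0 d zenv F.

Definition EConst (D d : nat) (x : expr) : expr := EMono D (fun _ => false) x 0 d.

Lemma ev_const rho A D d x v : loaded rho A D -> d <= D -> ev rho x = Some v ->
  ev rho (EConst D d x) = Some (table A D d (fun _ => v)).
Proof.
  intros HA Hd Hx; unfold EConst, table; rewrite (ev_mono rho A D _ x v HA Hx d 0 zenv Hd).
  f_equal; apply tab_ext; intros e' _; rewrite mono_none by auto; lia.
Qed.

(** An index outside the box reads [zenv], so its table is [0]. *)
Definition EVar (D d i : nat) : expr :=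
  if i <? d then EMono D (Nat.eqb i) (ECst 1) 0 d else ECst 0.

Lemma tab_zero n u c : forall l e, tab n u l c e (fun _ => 0) = 0.
Proof. intros l e; apply (tab_scale n u 0 c l e (fun _ => 0)). Qed.

Lemma ev_var rho A D d i : loaded rho A D -> d <= D ->
  ev rho (EVar D d i) = Some (table A D d (fun e => e i)).
Proof.
  intros HA Hd; unfold EVar, table; destruct (Nat.ltb_spec i d) as [Hi|Hi].
  - rewrite (ev_mono rho A D _ (ECst 1) 1 HA eq_refl d 0 zenv Hd).
    f_equal; apply tab_ext; intros e' _; rewrite mono_var by auto; lia.
  - simpl; f_equal; symmetry; etransitivity; [|apply (tab_zero A (level A D) d 0 zenv)].
    apply tab_ext; intros e' He'.
    pose proof (inbox_outer _ _ _ _ _ (i - d) He') as H0.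
    replace (d + (i - d)) with i in H0 by lia; now rewrite H0.
Qed.

Definition EProd (D d : nat) : expr :=
  if 1 <? d then EMono D (fun k => k <? 2) (ECst 1) 0 d else ECst 0.

Lemma ev_prod rho A D d : loaded rho A D -> d <= D ->
  ev rho (EProd D d) = Some (table A D d (fun e => e 0 * e 1)).
Proof.
  intros HA Hd; unfold EProd, table; destruct (Nat.ltb_spec 1 d) as [Hi|Hi].
  - rewrite (ev_mono rho A D _ (ECst 1) 1 HA eq_refl d 0 zenv Hd).
    f_equal; apply tab_ext; intros e' _; rewrite mono_two by auto; lia.
  - simpl; f_equal; symmetry; etransitivity; [|apply (tab_zero A (level A D) d 0 zenv)].
    apply tab_ext; intros e' He'.
    pose proof (inbox_outer _ _ _ _ _ (1 - d) He') as H0.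
    replace (d + (1 - d)) with 1 in H0 by lia; rewrite H0; unfold zenv; lia.
Qed.

(* Adding [2 ^ k - 1] to an entry below [2 ^ k] carries into bit [k] iff it is nonzero. *)
Definition ENonzero (D d : nat) (k x : expr) : expr :=
  EOp ODiv (EOp OAnd (EOp OAdd x (EConst D d (ESub (EPow k) (ECst 1)))) (EConst D d (EPow k)))
    (EPow k).

Lemma ev_nonzero rho A D d k kv x F : loaded rho A D -> d <= D ->
  ev rho k = Some kv -> kv + 1 <= 2 ^ level A D d ->
  (forall e, inbox A 0 d zenv e -> F e < 2 ^ kv) ->
  ev rho x = Some (table A D d F) ->
  ev rho (ENonzero D d k x) = Some (table A D d (fun e => Nat.b2n (0 <? F e))).
Proof.
  intros HA Hd Hk Hkv HF Hx; pose proof (pow2_pos kv) as Hpos.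
  assert (Hw : 2 ^ (kv + 1) <= 2 ^ 2 ^ level A D d) by (apply Nat.pow_le_mono_r; lia).
  assert (H2 : 2 ^ (kv + 1) = 2 * 2 ^ kv) by now rewrite Nat.add_1_r, Nat.pow_succ_r'.
  apply ev_div with (2 ^ kv); [|now apply ev_pow|lia].
  rewrite (ev_op rho OAnd _ _ (table A D d (fun e => F e + (2 ^ kv - 1)))
    (table A D d (fun _ => 2 ^ kv))).
  - cbn [eval_op]; f_equal; unfold table.
    rewrite (tab_bitwise A (level A D) D Nat.land d (level_spaced A D) bitwise_land 0 zenv _ _ Hd).
    + rewrite Nat.mul_comm, <- tab_scale; apply tab_ext; intros e He.
      specialize (HF e He); rewrite land_pow2 by lia.
      rewrite Nat.mul_comm; f_equal; f_equal.
      destruct (Nat.leb_spec (2 ^ kv) (F e + (2 ^ kv - 1))), (Nat.ltb_spec 0 (F e)); lia.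
    + intros e He; specialize (HF e He); simpl; lia.
    + intros e He; simpl; lia.
  - rewrite (ev_op rho OAdd _ _ _ _ Hx (ev_const rho A D d _ (2 ^ kv - 1) HA Hd
      (ev_sub rho (EPow k) (ECst 1) _ 1 (ev_pow _ _ _ Hk) eq_refl Hpos))).
    cbn [eval_op]; f_equal; symmetry; apply tab_add.
  - apply ev_const; auto; now apply ev_pow.
Qed.

(** Entries are equal iff their xor vanishes. They stay below [2 ^ 2 ^ A D], so bit [2 ^ A D] is
    free for the carry. *)
Definition EEq (D d : nat) (x y : expr) : expr :=
  EOp OXor (ENonzero D d (EPow (EReg (S D))) (EOp OXor x y)) (EConst D d (ECst 1)).

Lemma ev_negb rho A D d x (p : env -> bool) : loaded rho A D -> d <= D ->
  ev rho x = Some (table A D d (fun e => Nat.b2n (p e))) ->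
  ev rho (EOp OXor x (EConst D d (ECst 1))) =
  Some (table A D d (fun e => Nat.b2n (negb (p e)))).
Proof.
  intros HA Hd Hx; pose proof (pow_pow_gt_1 (level A D d)).
  rewrite (ev_op _ OXor _ _ _ _ Hx (ev_const rho A D d (ECst 1) 1 HA Hd eq_refl)).
  cbn [eval_op]; f_equal; unfold table.
  rewrite (tab_bitwise A (level A D) D Nat.lxor d (level_spaced A D) bitwise_lxor 0 zenv _ _ Hd).
  - apply tab_ext; intros e _; now destruct (p e).
  - intros e _; simpl; destruct (p e); simpl Nat.b2n; lia.
  - intros e _; simpl; lia.
Qed.

Lemma ev_eq rho A D d x y F G : loaded rho A D -> d <= D ->
  (forall e, inbox A 0 d zenv e -> F e < 2 ^ 2 ^ A D) ->
  (forall e, inbox A 0 d zenv e -> G e < 2 ^ 2 ^ A D) ->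
  ev rho x = Some (table A D d F) -> ev rho y = Some (table A D d G) ->
  ev rho (EEq D d x y) = Some (table A D d (fun e => Nat.b2n (F e =? G e))).
Proof.
  intros HA Hd HF HG Hx Hy.
  pose proof (level_ge A D d) as Hge.
  assert (Hle : 2 ^ A D + 1 <= 2 ^ level A D d).
  { apply Nat.le_trans with (2 ^ (A D + 1)); [|apply Nat.pow_le_mono_r; lia].
    rewrite (Nat.add_1_r (A D)), Nat.pow_succ_r'; pose proof (pow2_pos (A D)); lia. }
  assert (Hle' : 2 ^ 2 ^ A D <= 2 ^ 2 ^ level A D d) by (apply Nat.pow_le_mono_r; lia).
  unfold EEq.
  erewrite (ev_negb rho A D d _ (fun e => 0 <? Nat.lxor (F e) (G e)) HA Hd).
  - f_equal; unfold table; apply tab_ext; intros e _; f_equal.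
    destruct (Nat.eqb_spec (F e) (G e)) as [->|Hne]; [now rewrite Nat.lxor_nilpotent|].
    destruct (Nat.ltb_spec 0 (Nat.lxor (F e) (G e))) as [|H0]; [reflexivity|].
    contradict Hne; apply Nat.lxor_eq; lia.
  - apply ev_nonzero with (kv := 2 ^ A D); auto.
    + apply ev_pow; simpl; now rewrite HA.
    + intros e He; apply bitwise_lt; auto using bitwise_lxor.
    + rewrite (ev_op _ OXor _ _ _ _ Hx Hy); cbn [eval_op]; f_equal.
      apply (tab_bitwise A (level A D) D Nat.lxor d (level_spaced A D) bitwise_lxor 0 zenv _ _ Hd).
      * intros e He; specialize (HF e He); simpl; lia.
      * intros e He; specialize (HG e He); simpl; lia.
Qed.

Fixpoint qdepth (p : fo) : nat :=
  match p with
  | FoOne _ | FoAdd _ _ _ | FoMul => 0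
  | FoNot p => qdepth p
  | FoAnd p q => max (qdepth p) (qdepth q)
  | FoEx p => S (qdepth p)
  end.

Fixpoint bsat (A : nat -> nat) (d : nat) (e : env) (p : fo) : bool :=
  match p with
  | FoOne i => e i =? 1
  | FoAdd i j k => e i + e j =? e k
  | FoMul => e 0 * e 1 =? e 2
  | FoNot p => negb (bsat A d e p)
  | FoAnd p q => bsat A d e p && bsat A d e q
  | FoEx p => existsb (fun x => bsat A (S d) (scons x e) p) (seq 0 (2 ^ A d))
  end.

(** For [FoEx] the tested field is a full row: [2 ^ A d] entries of [2 ^ level A D (S d)] bits each,
    whence the sum in the exponent. *)
Fixpoint ETable (D d : nat) (p : fo) : expr :=
  match p with
  | FoOne i => EEq D d (EVar D d i) (EConst D d (ECst 1))
  | FoAdd i j k => EEq D d (EOp OAdd (EVar D d i) (EVar D d j)) (EVar D d k)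
  | FoMul => EEq D d (EProd D d) (EVar D d 2)
  | FoNot p => EOp OXor (ETable D d p) (EConst D d (ECst 1))
  | FoAnd p q => EOp OAnd (ETable D d p) (ETable D d q)
  | FoEx p => ENonzero D d (EPow (EOp OAdd (ELevel D (S d)) (EReg (S d)))) (ETable D (S d) p)
  end.

Lemma ev_table rho A D h : loaded rho A D -> (forall l, l < D -> A l <= h) ->
  2 * h + 1 <= A D -> forall p d, d + qdepth p <= D ->
  ev rho (ETable D d p) = Some (table A D d (fun e => Nat.b2n (bsat A d e p))).
Proof.
  intros HA Hh HD.
  assert (Hbox : forall d e, d <= D -> inbox A 0 d zenv e -> forall i, e i < 2 ^ h).
  { intros d e Hd; apply (inbox_lt A D h d Hh 0 zenv e Hd).
    intros i; apply pow2_pos. }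
  (* Entries must hold products of two variables below [2 ^ h], and also sums of two; this is where
     [2 * h + 1 <= A D] is spent. *)
  assert (Hw : 2 * (2 ^ h * 2 ^ h) <= 2 ^ 2 ^ A D).
  { rewrite <- Nat.pow_add_r, <- Nat.pow_succ_r'; apply Nat.pow_le_mono_r; [lia|].
    pose proof (Nat.pow_gt_lin_r 2 (A D)); lia. }
  pose proof (pow2_pos h) as Hh0.
  assert (Hw1 : 2 ^ h <= 2 ^ 2 ^ A D) by nia.
  induction p as [i|i j k| |p IH|p IH q IH'|p IH]; intros d Hd; simpl in Hd; simpl ETable.
  - apply ev_eq; [exact HA|lia|..].
    + intros e He; pose proof (Hbox d e ltac:(lia) He i); lia.
    + intros _ _; apply pow_pow_gt_1.
    + apply ev_var; auto; lia.
    + apply ev_const; auto; lia.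
  - apply ev_eq; [exact HA|lia|..].
    + intros e He; pose proof (Hbox d e ltac:(lia) He i);
        pose proof (Hbox d e ltac:(lia) He j); nia.
    + intros e He; pose proof (Hbox d e ltac:(lia) He k); lia.
    + rewrite (ev_op _ OAdd _ _ _ _ (ev_var rho A D d i HA ltac:(lia))
        (ev_var rho A D d j HA ltac:(lia))); cbn [eval_op]; f_equal; symmetry; apply tab_add.
    + apply ev_var; auto; lia.
  - apply ev_eq; [exact HA|lia|..].
    + intros e He; pose proof (Hbox d e ltac:(lia) He 0);
        pose proof (Hbox d e ltac:(lia) He 1); nia.
    + intros e He; pose proof (Hbox d e ltac:(lia) He 2); lia.
    + apply ev_prod; auto; lia.
    + apply ev_var; auto; lia.
  - apply ev_negb; auto; lia.
  - rewrite (ev_op _ OAnd _ _ _ _ (IH d ltac:(lia)) (IH' d ltac:(lia))); cbn [eval_op]; f_equal.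
    assert (Hb : forall b : bool, Nat.b2n b < 2 ^ 2 ^ level A D (0 + d)).
    { intros b; pose proof (pow_pow_gt_1 (level A D (0 + d))); destruct b; simpl Nat.b2n; lia. }
    unfold table.
    rewrite (tab_bitwise A (level A D) D Nat.land d (level_spaced A D) bitwise_land 0 zenv _ _
      ltac:(lia)) by auto.
    apply tab_ext; intros e _; cbn [bsat]; now destruct (bsat A d e p), (bsat A d e q).
  - specialize (IH (S d) ltac:(lia)).
    unfold table in IH; rewrite tab_last in IH; simpl in IH.
    pose proof (level_spaced A D d ltac:(lia)) as Hsp.
    rewrite (ev_nonzero rho A D d _ (2 ^ (level A D (S d) + A d))) with (6 := IH);
      auto; try lia.
    + f_equal; apply tab_ext; intros e He; simpl; f_equal.
      apply eq_true_iff_eq; rewrite Nat.ltb_lt, sumn_pos, existsb_exists.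
      split.
      * intros [x [Hx Hp]]; exists x; split; [apply in_seq; lia|].
        destruct (bsat A (S d) (scons x e) p); [reflexivity|simpl in Hp; lia].
      * intros [x [Hx Hp]]; apply in_seq in Hx; exists x; split; [lia|].
        rewrite Hp, <- Nat.pow_mul_r; simpl Nat.b2n.
        pose proof (pow2_pos (2 ^ level A D (S d) * x)); lia.
    + apply ev_pow.
      rewrite (ev_op _ OAdd _ _ _ (A d) (ev_level rho A D (S d) HA)); [reflexivity|].
      simpl; rewrite HA; auto; lia.
    + apply Nat.le_trans with (2 ^ (level A D (S d) + A d + 1));
        [|apply Nat.pow_le_mono_r; lia].
      rewrite (Nat.add_1_r (_ + A d)), Nat.pow_succ_r'.
      pose proof (pow2_pos (level A D (S d) + A d)); lia.
    + intros e He; rewrite Nat.pow_add_r, Nat.pow_mul_r; apply sumn_digits_lt.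
      intros x Hx; pose proof (pow_pow_gt_1 (level A D (S d))).
      destruct (bsat A (S d) (scons x e) p); simpl Nat.b2n; lia.
Qed.

(* The outermost coordinate of the table ranges over candidate inputs; the actual input
   selects one entry. *)
Definition EDecide (D : nat) (p : fo) : expr :=
  let t := EPow (EOp OShl (EReg 0) (ELevel D 1)) in
  EOp ODiv (EOp OAnd (ETable D 1 p) t) t.

Lemma ev_decide rho A D h p : loaded rho A D -> (forall l, l < D -> A l <= h) ->
  2 * h + 1 <= A D -> 1 + qdepth p <= D -> rho 0 < 2 ^ A 0 ->
  ev rho (EDecide D p) = Some (Nat.b2n (bsat A 1 (scons (rho 0) zenv) p)).
Proof.
  intros HA Hh HD Hp Hin.
  set (w := 2 ^ level A D 1).
  assert (Ht : ev rho (EPow (EOp OShl (EReg 0) (ELevel D 1))) = Some (2 ^ (rho 0 * w))).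
  { apply ev_pow; now rewrite (ev_op rho OShl (EReg 0) _ _ _ eq_refl (ev_level rho A D 1 HA)). }
  pose proof (pow2_pos (rho 0 * w)).
  apply ev_div with (2 ^ (rho 0 * w)); [|exact Ht|lia].
  rewrite (ev_op _ OAnd _ _ _ _ (ev_table rho A D h HA Hh HD p 1 Hp) Ht); cbn [eval_op]; f_equal.
  unfold table; rewrite tab_S; cbn [tab]; fold w.
  (* The one-bit mask is itself a digit sum, the indicator of the actual input, so the conjunction
     acts digit by digit. *)
  assert (E : 2 ^ (rho 0 * w) =
    sumn (fun x => Nat.b2n (x =? rho 0) * (2 ^ w) ^ x) (2 ^ A 0)).
  { rewrite (sumn_single _ _ (rho 0)); auto.
    - rewrite Nat.eqb_refl, <- Nat.pow_mul_r, (Nat.mul_comm w); simpl Nat.b2n; lia.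
    - intros x Hx; apply Nat.eqb_neq in Hx; now rewrite Hx. }
  rewrite E at 1.
  assert (Hb : forall b : bool, Nat.b2n b < 2 ^ w).
  { intros b; pose proof (pow_pow_gt_1 (level A D 1)); fold w in H0.
    destruct b; simpl Nat.b2n; lia. }
  rewrite bitwise_sumn by auto using bitwise_land.
  rewrite (sumn_single _ _ (rho 0)); auto.
  - rewrite Nat.eqb_refl, <- Nat.pow_mul_r, (Nat.mul_comm w); f_equal.
    now destruct (bsat A 1 (scons (rho 0) zenv) p).
  - intros x Hx; apply Nat.eqb_neq in Hx; rewrite Hx; simpl Nat.b2n.
    now rewrite Nat.land_0_r.
Qed.

(** * Straight-line programs *)

Fixpoint rbound (x : expr) : nat :=
  match x with
  | EReg i => S i
  | ECst _ => 0
  | EOp _ x y => max (rbound x) (rbound y)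
  end.

(** Stack discipline: the result goes to [b], registers below [b] are preserved, those above are
    scratch. Starting at [rbound x] protects all registers that [x] reads. *)
Fixpoint compile (b : nat) (x : expr) : program :=
  match x with
  | EReg i => [IMove b i]
  | ECst c => [IConst b c]
  | EOp o x y => compile b x ++ compile (S b) y ++ [IOp o b b (S b)]
  end.

Lemma ev_ext rho rho' x : (forall i, i < rbound x -> rho i = rho' i) -> ev rho x = ev rho' x.
Proof.
  induction x as [j|c|o x IHx y IHy]; simpl; intros H.
  - rewrite H; auto.
  - reflexivity.
  - rewrite IHx, IHy; auto; intros i Hi; apply H; lia.
Qed.

Definition segment (P : program) (pc : nat) (code : program) : Prop :=
  forall i ins, nth_error code i = Some ins -> nth_error P (pc + i) = Some ins.

Lemma segment_app P pc c1 c2 : segment P pc (c1 ++ c2) ->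
  segment P pc c1 /\ segment P (pc + length c1) c2.
Proof.
  intros H; split; intros i ins Hi.
  - apply H; rewrite nth_error_app1; auto.
    apply nth_error_Some; congruence.
  - rewrite <- Nat.add_assoc; apply H.
    rewrite nth_error_app2 by lia; now replace (length c1 + i - length c1) with i by lia.
Qed.

Lemma compile_spec P A k x : forall b pc r v, segment P pc (compile b x) ->
  rbound x <= b -> ev r x = Some v ->
  exists r', (forall i, i < b -> r' i = r i) /\ r' b = v /\
    exec P A (length (compile b x)) (Running (Cfg pc r k)) =
    Running (Cfg (pc + length (compile b x)) r' k).
Proof.
  induction x as [j|c|o x IHx y IHy]; intros b pc r v HP Hb Hv; simpl in Hv, Hb.
  - exists (upd r b (r j)); split; [|split].
    + intros i Hi; rewrite upd_neq; auto; lia.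
    + rewrite upd_eq; congruence.
    + specialize (HP 0 _ eq_refl); rewrite Nat.add_0_r in HP.
      simpl; unfold step; simpl; rewrite HP, Nat.add_1_r; reflexivity.
  - exists (upd r b c); split; [|split].
    + intros i Hi; rewrite upd_neq; auto; lia.
    + rewrite upd_eq; congruence.
    + specialize (HP 0 _ eq_refl); rewrite Nat.add_0_r in HP.
      simpl; unfold step; simpl; rewrite HP, Nat.add_1_r; reflexivity.
  - destruct (ev r x) as [a|] eqn:Hx; [|discriminate].
    destruct (ev r y) as [a'|] eqn:Hy; [|discriminate].
    simpl compile in *.
    apply segment_app in HP; destruct HP as [HP1 HP].
    apply segment_app in HP; destruct HP as [HP2 HP3].
    destruct (IHx b pc r a HP1) as [r1 [H1 [H1b E1]]]; auto; [lia|].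
    destruct (IHy (S b) _ r1 a' HP2) as [r2 [H2 [H2b E2]]]; [lia| |].
    { rewrite <- Hy; apply ev_ext; intros i Hi; apply H1; lia. }
    specialize (HP3 0 _ eq_refl); rewrite Nat.add_0_r in HP3.
    exists (upd r2 b v); split; [|split].
    + intros i Hi; rewrite upd_neq, H2, H1; auto; lia.
    + apply upd_eq.
    + rewrite !length_app, !exec_add, E1, E2; simpl.
      unfold step; simpl; rewrite HP3, H2b, H2, H1b, Hv by lia.
      f_equal; f_equal; lia.
Qed.

Lemma load_spec P A m : forall pc r k, segment P pc (map IAln (seq (S k) m)) ->
  exists r', r' 0 = r 0 /\ (forall l, l < k -> r' (S l) = r (S l)) /\
    (forall l, k <= l < k + m -> r' (S l) = A l) /\
    exec P A m (Running (Cfg pc r k)) = Running (Cfg (pc + m) r' (k + m)).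
Proof.
  induction m as [|m IH]; intros pc r k HP.
  - exists r; repeat split; auto; [lia|simpl; now rewrite !Nat.add_0_r].
  - pose proof (HP 0 _ eq_refl) as H0; rewrite Nat.add_0_r in H0.
    destruct (IH (S pc) (upd r (S k) (A k)) (S k)) as [r' [H1 [H2 [H3 E]]]].
    { intros i ins Hi; rewrite Nat.add_succ_comm; now apply HP. }
    exists r'; split; [|split; [|split]].
    + rewrite H1; apply upd_neq; lia.
    + intros l Hl; rewrite H2 by lia; apply upd_neq; lia.
    + intros l Hl; destruct (Nat.eq_dec l k) as [->|]; [|apply H3; lia].
      rewrite H2 by lia; apply upd_eq.
    + simpl; unfold step; simpl; rewrite H0, E.
      f_equal; f_equal; lia.
Qed.

Definition no_jump (ins : instr) : Prop :=
  match ins with IJeq _ _ _ => False | _ => True end.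

(** Each step advances the program counter or stops the run, whatever the values of [A]; the time
    bound is required for all sequences, not only for good ones. *)
Lemma no_jump_stops P A : Forall no_jump P -> forall n c, length P <= pc c + n ->
  stopped (exec P A (S n) (Running c)).
Proof.
  intros HP; induction n as [|n IH]; intros c Hn; cbn [exec];
    destruct (nth_error P (pc c)) as [ins|] eqn:Hi.
  - assert (pc c < length P) by (apply nth_error_Some; congruence); lia.
  - unfold step; now rewrite Hi.
  - apply nth_error_In in Hi as Hin.
    rewrite Forall_forall in HP; specialize (HP _ Hin).
    assert (Hs : stopped (step P A c) \/ exists c', step P A c = Running c' /\ pc c' = S (pc c)).
    { unfold step; rewrite Hi; destruct ins; simpl in *; eauto; try tauto.
      destruct (eval_op _ _ _); simpl; eauto. }
    destruct Hs as [Hs|[c' [-> Hc]]].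
    + destruct (step P A c); [destruct Hs|exact I|exact I].
    + apply IH; lia.
  - unfold step; now rewrite Hi.
Qed.

Lemma compile_no_jump x : forall b, Forall no_jump (compile b x).
Proof.
  induction x as [j|c|o x IHx y IHy]; intros b; simpl.
  - repeat constructor.
  - repeat constructor.
  - rewrite !Forall_app; repeat split; auto; repeat constructor.
Qed.

Definition decider (D : nat) (x : expr) : program :=
  map IAln (seq 1 (S D)) ++ compile (rbound x) x ++ [IMove 0 (rbound x)].

Lemma decider_no_jump D x : Forall no_jump (decider D x).
Proof.
  unfold decider; rewrite !Forall_app; split; [|split].
  - apply Forall_map, Forall_forall; intros; exact I.
  - apply compile_no_jump.
  - repeat constructor.
Qed.

Lemma decider_spec D x A inp v :
  (forall rho, loaded rho A D -> rho 0 = inp -> ev rho x = Some v) ->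
  exists r, exec (decider D x) A (S (length (decider D x))) (init inp) = Halted r /\ r 0 = v.
Proof.
  intros Hx; set (P := decider D x).
  assert (HP : segment P 0 P) by (intros i ins Hi; exact Hi).
  unfold P at 2 in HP; unfold decider in HP.
  apply segment_app in HP; destruct HP as [HP1 HP].
  apply segment_app in HP; destruct HP as [HP2 HP3].
  rewrite length_map, length_seq in *.
  destruct (load_spec P A (S D) 0 (fun y => if Nat.eqb y 0 then inp else 0) 0 HP1)
    as [r1 [H0 [_ [H1 E1]]]].
  assert (Hev : ev r1 x = Some v).
  { apply Hx; [|exact H0]; intros l Hl; apply H1; lia. }
  destruct (compile_spec P A (0 + S D) x _ _ r1 v HP2 (le_n _) Hev) as [r2 [_ [H2 E2]]].
  specialize (HP3 0 _ eq_refl); rewrite Nat.add_0_r in HP3.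
  exists (upd r2 0 v); split; [|apply upd_eq].
  assert (HL : length P = S D + (length (compile (rbound x) x) + 1)).
  { unfold P, decider; now rewrite !length_app, length_map, length_seq. }
  (* The last two steps are the final move and the one that finds the program counter past the
     end. *)
  replace (S (length P)) with (S D + (length (compile (rbound x) x) + 2)) by lia.
  rewrite !exec_add; unfold init; rewrite E1, E2.
  set (c := Cfg _ r2 _).
  assert (E3 : step P A c = Running (Cfg (S (pc c)) (upd r2 0 (r2 (rbound x))) (nalns c)))
    by (unfold step, c; cbn [pc rg]; now rewrite HP3).
  cbn [exec]; rewrite E3; unfold step, c; cbn [pc rg].
  replace (nth_error P _) with (@None instr); [now rewrite H2|].
  symmetry; apply nth_error_None; lia.
Qed.

(** * Almost all bounds decide a formula *)

(** For [FoEx] the threshold admits a witness, if there is one. Once the bound [x] is fixed, only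
    finitely many [y] remain, and their conditions on the deeper bounds are joined by
    [almost_forall_lt]; the deeper thresholds may thus depend on [x]. *)
Lemma almost_bsat p : forall d e r A, qdepth p <= r ->
  almost d r A (fun A' => bsat A' d e p = true <-> fosat e p).
Proof.
  induction p as [i|i j k| |p IH|p IH q IH'|p IH]; intros d e r A Hr; simpl in Hr.
  - apply almost_true; intros; apply Nat.eqb_eq.
  - apply almost_true; intros; apply Nat.eqb_eq.
  - apply almost_true; intros; apply Nat.eqb_eq.
  - generalize (IH d e r A Hr); apply almost_impl; intros A' _ H; simpl.
    rewrite <- H; destruct (bsat A' d e p); simpl; intuition congruence.
  - generalize (almost_and _ _ _ _ _ (IH d e r A ltac:(lia)) (IH' d e r A ltac:(lia))).
    apply almost_impl; intros A' _ [H H']; simpl.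
    now rewrite andb_true_iff, H, H'.
  - destruct r as [|r]; [lia|].
    assert (HN : exists N, fosat e (FoEx p) -> exists y, y < 2 ^ N /\ fosat (scons y e) p).
    { destruct (classic (fosat e (FoEx p))) as [[y Hy]|Hn].
      - exists y; intros _; exists y; split; auto; apply Nat.pow_gt_lin_r; lia.
      - exists 0; tauto. }
    destruct HN as [N HN]; exists N; intros x Hx.
    apply almost_impl with (Q1 := fun A' => forall y, y < 2 ^ x ->
      (bsat A' (S d) (scons y e) p = true <-> fosat (scons y e) p)).
    + intros A' HA' H; simpl bsat; rewrite <- HA', upd_eq by lia.
      rewrite existsb_exists; split.
      * intros [y [Hy Hb]]; apply in_seq in Hy; exists y; apply H; auto; lia.
      * intros Hs; destruct (HN Hs) as [y [Hy Hf]].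
        assert (y < 2 ^ x)
          by (apply Nat.lt_le_trans with (1 := Hy), Nat.pow_le_mono_r; lia).
        exists y; split; [apply in_seq; lia|now apply H].
    + apply almost_forall_lt; intros y _; apply IH; lia.
Qed.

(** The value at [D] is chosen after those below [D], so its threshold may depend on them. *)
Lemma almost_dominates D r A : D < r ->
  almost 0 r A (fun A' => exists h, (forall l, l < D -> A' l <= h) /\ 2 * h + 1 <= A' D).
Proof.
  intros Hr; replace r with (D + S (r - S D)) by lia.
  apply almost_skip; intros A'; simpl Nat.add.
  assert (Hh : exists h, forall l, l < D -> A' l <= h).
  { clear Hr; induction D as [|D [h Hh]]; [exists 0; lia|].
    exists (h + A' D); intros l Hl; destruct (Nat.eq_dec l D) as [->|]; [lia|].
    specialize (Hh l); lia. }
  destruct Hh as [h Hh]; exists (2 * h + 1); intros x Hx.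
  apply almost_true; intros B HB; exists h; split.
  - intros l Hl; rewrite <- HB, upd_neq by lia; auto.
  - rewrite <- HB, upd_eq by lia; exact Hx.
Qed.

Lemma AH_O1_ASRAM L : AH L -> O1_ASRAM_language L.
Proof.
  intros HL; destruct (AH_definable L HL) as [p Hp].
  (* One level for the input and one for each nested quantifier. *)
  set (D := S (qdepth p)); set (P := decider D (EDecide D p)).
  exists P; split.
  - exists (fun inp => if excluded_middle_informative (L inp) then 1 else 0); split.
    + intros inp.
      set (v := if excluded_middle_informative (L inp) then 1 else 0).
      set (T := S (length P)).
      assert (HT : S D < T).
      { unfold T, P, decider; rewrite length_app, length_map, length_seq, length_app; simpl; lia. }
      destruct (almost_ALS T
        (fun A => exists r, exec P A T (init inp) = Halted r /\ r 0 = v) (fun _ => 0))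
        as [S [HS HQ]].
      * intros A B HAB [r [Hr Hv]]; exists r; split; auto.
        unfold init in *; rewrite <- (exec_agree P T T A B); auto.
      * apply almost_impl with (Q1 := fun A =>
          (exists h, (forall l, l < D -> A l <= h) /\ 2 * h + 1 <= A D) /\
          inp < 2 ^ A 0 /\ (bsat A 1 (scons inp zenv) p = true <-> fosat (scons inp zenv) p)).
        -- intros A _ [[h [Hh HD]] [Hin Hb]].
           apply decider_spec; intros rho HA <-.
           rewrite (ev_decide rho A D h p); auto.
           unfold v; destruct (excluded_middle_informative _) as [Hl|Hl];
             rewrite Hp, <- Hb in Hl; destruct (bsat _ _ _ _); simpl; congruence.
        -- apply almost_and; [apply almost_dominates; lia|].
           (* A first value of at least [inp] puts the input into the box of side [2 ^ A 0]; the
              formula then starts at depth [1]. *)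
           unfold T; exists inp; intros x Hx; fold almost.
           apply almost_and.
           ++ apply almost_true; intros A' HA'; rewrite <- HA', upd_eq by lia.
              apply Nat.le_lt_trans with (1 := Hx), Nat.pow_gt_lin_r; lia.
           ++ apply almost_bsat; unfold D, T in HT; lia.
      * exists S; split; auto; intros A HA; exists T; auto.
    + intros inp; destruct (excluded_middle_informative (L inp)); split; auto; tauto || lia.
  - exists (S (length P)); intros inp A.
    apply no_jump_stops; [apply decider_no_jump|apply Nat.le_add_l].
Qed.

Theorem theorem3 : forall L : nat -> Prop, O1_ASRAM_language L <-> AH L.
Proof. intros L; split; [apply O1_ASRAM_AH|apply AH_O1_ASRAM]. Qed.
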